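(* There exists a function $\varepsilon : \mathbb{Z}_{\geq 1} \to \mathbb{R}$ with $\varepsilon(n) \to 0$ as $n \to \infty$ such that for every $n \geq 1$, $$T_n < \frac{2^{\beta_n}}{2\pi\sqrt{e}} + \varepsilon(n),$$ where $T_n := \frac{1}{n} \cdot \sup_{\mathcal{L} \subset \mathbb{R}^n} \mu(\mathcal{L}) \lambda_1(\mathcal{L}^* )$, the supremum being over all lattices in $\mathbb{R}^n$, and $$\beta_n := \frac{1}{n}\cdot \log_2 \sup_{\mathcal{L} \subset \mathbb{R}^n,\ \alpha \geq 1} \frac{N_\alpha(\mathcal{L})}{\alpha^n},$$ the supremum being over all lattices $\mathcal{L} \subset \mathbb{R}^n$ and all real $\alpha \geq 1$, with $N_\alpha(\mathcal{L}) := |\{\boldsymbol{y} \in \mathcal{L} : 0 < \|\boldsymbol{y}\| \leq \alpha \lambda_1(\mathcal{L})\}|$.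
   Context: A lattice $\mathcal{L} \subset \mathbb{R}^n$ is the set of all integer linear combinations $z_1 \boldsymbol{b}_1 + \cdots + z_n \boldsymbol{b}_n$ ($z_i \in \mathbb{Z}$) of $n$ linearly independent vectors $\boldsymbol{b}_1, \ldots, \boldsymbol{b}_n \in \mathbb{R}^n$ (so lattices are full rank). The dual lattice is $\mathcal{L}^* := \{\boldsymbol{w} \in \mathbb{R}^n : \langle \boldsymbol{w}, \boldsymbol{y}\rangle \in \mathbb{Z} \text{ for all } \boldsymbol{y} \in \mathcal{L}\}$. With $\|\cdot\|$ the Euclidean norm, $\lambda_1(\mathcal{L}) := \min_{\boldsymbol{y} \in \mathcal{L}\setminus\{\boldsymbol{0}\}} \|\boldsymbol{y}\|$ is the length of a shortest non-zero lattice vector, and $\mu(\mathcal{L}) := \max_{\boldsymbol{t} \in \mathbb{R}^n} \min_{\boldsymbol{y} \in \mathcal{L}} \|\boldsymbol{y} - \boldsymbol{t}\|$ is the covering radius. *)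

(* Defs.v *)
From mathcomp Require Import all_boot all_order all_algebra archimedean.
From mathcomp Require Import all_classical all_reals all_analysis.

Set Implicit Arguments.
Unset Strict Implicit.
Unset Printing Implicit Defensive.

Import Order.TTheory GRing.Theory Num.Theory.
Local Open Scope classical_set_scope.
Local Open Scope ring_scope.

(* The norm `|_| that the library puts on row vectors is the sup norm, so the *)
(* Euclidean structure of R^n is defined here.                                *)
Definition dotv (R : realType) (n : nat) (u v : 'rV[R]_n) : R :=
  \sum_(i < n) u 0 i * v 0 i.

Definition enorm (R : realType) (n : nat) (u : 'rV[R]_n) : R :=
  Num.sqrt (dotv u u).

(* The basis vectors are the rows of B.                                       *)
Definition lattice_of (R : realType) (n : nat) (B : 'M[R]_n) : set 'rV[R]_n :=
  [set y | exists z : 'I_n -> int, y = \sum_(i < n) (z i)%:~R *: row i B].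

Definition is_lattice (R : realType) (n : nat) (L : set 'rV[R]_n) : Prop :=
  exists2 B : 'M[R]_n, row_free B & L = lattice_of B.

Definition dual_lattice (R : realType) (n : nat) (L : set 'rV[R]_n) :
    set 'rV[R]_n :=
  [set w | forall y, L y -> dotv w y \is a Num.int].

(* In dimension n >= 1 the set of norms is non-empty and bounded below, and   *)
(* the infimum is a minimum because lattices are discrete.                    *)
Definition lambda1 (R : realType) (n : nat) (L : set 'rV[R]_n) : R :=
  inf [set enorm y | y in L `\ 0].

(* For a lattice the distances are bounded (lattices have full rank), and     *)
(* both extrema are attained, so that sup and inf are max and min.            *)
Definition covering_radius (R : realType) (n : nat) (L : set 'rV[R]_n) : R :=
  sup [set inf [set enorm (y - t) | y in L] | t in [set: 'rV[R]_n]].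

Definition short_vectors (R : realType) (n : nat) (alpha : R)
    (L : set 'rV[R]_n) : set 'rV[R]_n :=
  [set y | L y /\ 0 < enorm y <= alpha * lambda1 L].

(* Cardinalities and the suprema over all lattices are taken in the extended  *)
(* reals, so that they need no finiteness assumption to be meaningful.        *)
Definition num_short (R : realType) (n : nat) (alpha : R)
    (L : set 'rV[R]_n) : \bar R :=
  counting (short_vectors alpha L).

Local Open Scope ereal_scope.

Definition log2e (R : realType) (x : \bar R) : \bar R := lne x / (ln 2)%:E.

Definition exp2e (R : realType) (x : \bar R) : \bar R := expeR (x * (ln 2)%:E).

Lemma log2e_EFin (R : realType) (r : R) :
  (0 < r)%R -> log2e r%:E = (ln r / ln 2)%:E.
Proof.
move=> r0; rewrite /log2e lne_EFin// inver gt_eqF ?EFinM//.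
by rewrite ln_gt0// ltr1n.
Qed.

Lemma exp2e_EFin (R : realType) (r : R) : exp2e r%:E = (2 `^ r)%:E.
Proof. by rewrite /exp2e -EFinM /= /powR pnatr_eq0. Qed.

Definition transference (R : realType) (n : nat) : \bar R :=
  (n%:R^-1)%:E *
  ereal_sup [set (covering_radius L * lambda1 (dual_lattice L))%:E
            | L in [set L : set 'rV[R]_n | is_lattice L]].

Definition beta_count (R : realType) (n : nat) : \bar R :=
  (n%:R^-1)%:E *
  log2e (ereal_sup [set num_short p.2 p.1 / (p.2 ^+ n)%:E
                   | p in [set p : set 'rV[R]_n * R
                          | is_lattice p.1 /\ (1 <= p.2)%R]]).

(* Main.v *)
Require Import Defs.
From mathcomp Require Import all_boot all_order all_algebra archimedean finmap.
From mathcomp Require Import all_classical all_reals all_analysis.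
From mathcomp Require Import ring lra zify.

Set Implicit Arguments.
Unset Strict Implicit.
Unset Printing Implicit Defensive.

Import Order.TTheory GRing.Theory Num.Theory.
Import numFieldNormedType.Exports.
Local Open Scope classical_set_scope.
Local Open Scope ring_scope.

(** By Poisson summation, the Gaussian mass (at scale s) of a shifted lattice
    L - x is a factor independent of x times a number between 1 - r and 1 + r,
    where r is the mass (at scale 1/s) of the dual lattice minus 0.  By
    Banaszczyk's tail bound, the points of L - x outside a ball slightly larger
    than the typical radius sqrt(n / 2 pi) s carry exponentially little mass.
    So if r <= 1/2, then that ball meets L - x for every x, which bounds the
    covering radius.  The condition r <= 1/2 holds as soon as the minimum of
    the dual lattice is a bit larger than sqrt(n / 2 pi) / s (the tail bound
    again, which gives a uniform bound on T_n), and also as soon as it is a bit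
    larger than 2^beta_n sqrt(n / 2 pi e) / s (by counting dual vectors in
    shells).  The second condition gives the theorem up to a factor tending to
    1, which the uniform bound turns into an additive error. *)

(** * Sums of absolutely summable families *)

(** The threshold 2^beta sqrt(n / 2 pi e) / s comes from one optimisation. About 2^(beta n) alpha^n
    dual vectors at most have norm up to alpha times the minimum lam, and near that norm each weighs
    exp(- pi s^2 alpha^2 lam^2). The product is largest at alpha^2 = n / (2 pi s^2 lam^2), with
    value (2^(2 beta) n / (2 pi e s^2 lam^2))^(n/2). It is exponentially small as soon as lam
    exceeds the threshold by a fixed factor. Multiplying the threshold by the radius sqrt(n / 2 pi)
    s cancels s and leaves n 2^beta / (2 pi sqrt e). Poisson summation is derived without integrals:
    a finite trigonometric identity modulo an odd number tends term by term to the one-dimensional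
    formula, and a Schur complement carries this to n dimensions. The normalising factor of a
    lattice is never computed: it is only used in comparisons of two masses, where it cancels, so
    that its positivity and its independence of scale and shift suffice. *)

Section Tsum.
Variable R : realType.
Implicit Types (T : choiceType).

Definition summ T (f : T -> R) : Prop :=
  (\esum_(x in [set: T]) `|f x|%:E < +oo)%E.

(* [nsum] is meant for non-negative families; it is 0 when the sum diverges. *)
Definition nsum T (f : T -> R) : R := fine (\esum_(x in [set: T]) (f x)%:E).

Definition tsum T (f : T -> R) : R :=
  nsum (fun x => Num.max (f x) 0) - nsum (fun x => Num.max (- f x) 0).

Lemma summ_le T (f g : T -> R) :
  (forall x, `|f x| <= g x) -> summ g -> summ f.
Proof.
move=> fg; apply: le_lt_trans; apply: le_esum => x _.
by rewrite lee_fin (le_trans (fg x))// ler_norm.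
Qed.

Lemma summ_esum T (f : T -> R) : (forall x, 0 <= f x) ->
  (\esum_(x in [set: T]) (f x)%:E < +oo)%E -> summ f.
Proof.
move=> f0; rewrite /summ; congr (_ < _)%E.
by apply: eq_esum => x _; rewrite ger0_norm.
Qed.

Lemma nsumE T (f : T -> R) : (forall x, 0 <= f x) -> summ f ->
  (nsum f)%:E = (\esum_(x in [set: T]) (f x)%:E)%E.
Proof.
move=> f0 sf; rewrite /nsum fineK// ge0_fin_numE.
  apply: le_lt_trans sf; apply: le_esum => x _; rewrite lee_fin; exact: ler_norm.
by apply: esum_ge0 => x _; rewrite lee_fin.
Qed.

Lemma nsum_ge0 T (f : T -> R) : (forall x, 0 <= f x) -> 0 <= nsum f.
Proof.
by move=> f0; rewrite fine_ge0//; apply: esum_ge0 => x _; rewrite lee_fin.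
Qed.

Lemma summD T (f g : T -> R) : summ f -> summ g -> summ (fun x => f x + g x).
Proof. exact: (@summableD _ _ setT (EFin \o f) (EFin \o g)). Qed.

Lemma summN T (f : T -> R) : summ f -> summ (fun x => - f x).
Proof. by apply: le_lt_trans; apply: le_esum => x _; rewrite normrN. Qed.

Lemma summ_norm T (f : T -> R) : summ f -> summ (fun x => `|f x|).
Proof. by apply: le_lt_trans; apply: le_esum => x _; rewrite normr_id. Qed.

Lemma nsumD T (f g : T -> R) : (forall x, 0 <= f x) -> (forall x, 0 <= g x) ->
  summ f -> summ g -> nsum (fun x => f x + g x) = nsum f + nsum g.
Proof.
move=> f0 g0 sf sg; apply: EFin_inj; rewrite EFinD !nsumE//.
- by rewrite -esumD// => x _; rewrite lee_fin.
- by move=> x; rewrite addr_ge0.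
- exact: summD.
Qed.

Let max0_ge0 (x : R) : 0 <= Num.max x 0. Proof. by rewrite le_max lexx orbT. Qed.

(** The identity p + (p - n)^- = n + (p - n)^+ involves non-negative families only, where [nsum] is
    additive. Hence any splitting into summable non-negative families computes [tsum], which is what
    linearity rests on. *)
Lemma tsum_sub T (p n : T -> R) : (forall x, 0 <= p x) -> (forall x, 0 <= n x) ->
  summ p -> summ n -> tsum (fun x => p x - n x) = nsum p - nsum n.
Proof.
move=> p0 n0 sp sn; rewrite /tsum.
set a := fun x : T => _; set b := fun x : T => Num.max (- _) _.
have E x : p x + b x = n x + a x.
  rewrite /a /b opprB; case: (lerP 0 (p x - n x)) => h.
    by rewrite max_r; lra.
  by rewrite max_l; lra.
have sa : summ a.
  apply: (summ_le (g := p)) => // x; rewrite ger0_norm ?max0_ge0// /a.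
  by rewrite ge_max p0 andbT gerBl.
have sb : summ b.
  apply: (summ_le (g := n)) => // x; rewrite ger0_norm ?max0_ge0// /b.
  by rewrite opprB ge_max n0 andbT gerBl.
have : nsum (fun x => p x + b x) = nsum (fun x => n x + a x).
  by congr (fine _); apply: eq_esum => x _; rewrite E.
have h x : 0 <= a x by exact: max0_ge0.
have h' x : 0 <= b x by exact: max0_ge0.
rewrite !nsumD// => ?; lra.
Qed.

Lemma nsum0 T : nsum (fun _ : T => 0 : R) = 0.
Proof. by rewrite /nsum esum1. Qed.

Lemma tsum_nsum T (f : T -> R) : (forall x, 0 <= f x) -> tsum f = nsum f.
Proof.
move=> f0; rewrite /tsum (_ : (fun x => Num.max (- f x) 0) = fun=> 0).
  rewrite nsum0 subr0; congr nsum; apply: funext => x; exact/max_idPl.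
by apply: funext => x; apply/max_idPr; rewrite oppr_le0.
Qed.

Lemma summ_pos T (f : T -> R) : summ f -> summ (fun x => Num.max (f x) 0).
Proof.
move=> sf; apply: (summ_le _ (summ_norm sf)) => x.
by rewrite ger0_norm ?max0_ge0// ge_max ler_norm normr_ge0.
Qed.

Lemma summ_neg T (f : T -> R) : summ f -> summ (fun x => Num.max (- f x) 0).
Proof. by move=> /summN/summ_pos. Qed.

Lemma max_subE (x : R) : x = Num.max x 0 - Num.max (- x) 0.
Proof. by case: (lerP 0 x) => h; [rewrite max_r|rewrite max_l]; lra. Qed.

Lemma tsumD T (f g : T -> R) : summ f -> summ g ->
  tsum (fun x => f x + g x) = tsum f + tsum g.
Proof.
move=> sf sg.
transitivity (tsum (fun x => (Num.max (f x) 0 + Num.max (g x) 0) -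
   (Num.max (- f x) 0 + Num.max (- g x) 0))).
  congr tsum; apply: funext => x.
  by rewrite {1}[f x]max_subE {1}[g x]max_subE; ring.
rewrite tsum_sub.
- rewrite !nsumD; try exact: summ_pos; try exact: summ_neg;
    try by move=> x; exact: max0_ge0.
  by rewrite /tsum; ring.
- by move=> x; rewrite addr_ge0 ?max0_ge0.
- by move=> x; rewrite addr_ge0 ?max0_ge0.
- by apply: summD; exact: summ_pos.
- by apply: summD; exact: summ_neg.
Qed.

Lemma tsumN T (f : T -> R) : tsum (fun x => - f x) = - tsum f.
Proof.
by rewrite /tsum; under [X in _ - nsum X]eq_fun do rewrite opprK; rewrite opprB.
Qed.

Lemma eq_tsum T (f g : T -> R) : f =1 g -> tsum f = tsum g.
Proof. by move=> /funext ->. Qed.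

Lemma summZ T (c : R) (f : T -> R) : summ f -> summ (fun x => c * f x).
Proof.
move=> sf; rewrite /summ.
have -> : (\esum_(x in [set: T]) `|c * f x|%:E =
   ereal_sup [set (`|c|%:E * x)%E | x in
     [set \sum_(x \in A) `|f x|%:E%E | A in fsets [set: T]]])%E.
  rewrite /esum; congr ereal_sup; apply/seteqP; split => [_ [A hA <-]|_ [_ [A hA <-]] <-].
    exists (\sum_(x \in A) `|f x|%:E)%E; first by exists A.
    rewrite ge0_mule_fsumr; last by move=> x; rewrite lee_fin.
    by apply: eq_fsbigr => x _; rewrite normrM EFinM.
  exists A => //; rewrite ge0_mule_fsumr; last by move=> x; rewrite lee_fin.
  by apply: eq_fsbigr => x _; rewrite normrM EFinM.
rewrite ereal_supZl//; last first.
  by apply/set0P; exists 0%E, set0; [exact: fsets_set0|rewrite fsbig_set0].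
by rewrite lte_mul_pinfty.
Qed.

Lemma le_nsum T (f g : T -> R) : (forall x, 0 <= f x) -> (forall x, f x <= g x) ->
  summ g -> nsum f <= nsum g.
Proof.
move=> f0 fg sg; rewrite -lee_fin !nsumE//; last 2 first.
- by move=> x; exact: le_trans (fg x).
- by apply: (summ_le _ sg) => x; rewrite ger0_norm.
by apply: le_esum => x _; rewrite lee_fin.
Qed.

Lemma tsum_ge0 T (f : T -> R) : (forall x, 0 <= f x) -> 0 <= tsum f.
Proof. by move=> f0; rewrite tsum_nsum// nsum_ge0. Qed.

Lemma le_tsum T (f g : T -> R) : (forall x, f x <= g x) ->
  summ f -> summ g -> tsum f <= tsum g.
Proof.
move=> fg sf sg; rewrite -subr_ge0 -tsumN -tsumD//; last exact: summN.
by apply: tsum_ge0 => x; rewrite subr_ge0.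
Qed.

Lemma norm_tsum T (f : T -> R) : summ f -> `|tsum f| <= tsum (fun x => `|f x|).
Proof.
move=> sf; have sn := summ_norm sf; rewrite ler_norml -tsumN; apply/andP; split.
  by apply: le_tsum => // [x|]; [rewrite lerNl ler_normr lexx orbT|exact: summN].
by apply: le_tsum => // x; exact: ler_norm.
Qed.

Lemma tsumZ T (c : R) (f : T -> R) : summ f -> tsum (fun x => c * f x) = c * tsum f.
Proof.
move=> sf.
have pos (g : T -> R) (d : R) : 0 <= d -> (forall x, 0 <= g x) -> summ g ->
    nsum (fun x => d * g x) = d * nsum g.
  move=> d0 g0 sg; apply: EFin_inj; rewrite EFinM !nsumE//; last 2 first.
  - by move=> x; rewrite mulr_ge0.
  - exact: summZ.
  rewrite /esum -ereal_supZl//.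
    congr ereal_sup; apply/seteqP; split => [_ [A hA <-]|_ [_ [A hA <-]] <-].
      exists (\sum_(x \in A) (g x)%:E)%E; first by exists A.
      by rewrite ge0_mule_fsumr// => x; rewrite lee_fin.
    by exists A => //; rewrite ge0_mule_fsumr// => x; rewrite lee_fin.
  by apply/set0P; exists 0%E, set0; [exact: fsets_set0|rewrite fsbig_set0].
have posc (d : R) : 0 <= d -> tsum (fun x => d * f x) = d * tsum f.
  move=> d0; rewrite mulrBr -!pos//; [|exact: summ_neg|exact: summ_pos].
  rewrite -tsum_sub.
  - by apply: eq_tsum => x; rewrite -mulrBr -max_subE.
  - by move=> x; rewrite mulr_ge0.
  - by move=> x; rewrite mulr_ge0.
  - by apply: summZ; exact: summ_pos.
  - by apply: summZ; exact: summ_neg.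
case: (lerP 0 c) => c0; first exact: posc.
rewrite -[c]opprK mulNr -posc ?oppr_ge0 ?(ltW c0)// -tsumN.
by apply: eq_tsum => x; rewrite mulNr.
Qed.

Lemma tsum_reindex T T' (e : T -> T') (f : T' -> R) :
  bijective e -> tsum f = tsum (f \o e).
Proof.
move=> be; rewrite /tsum /nsum.
by rewrite !(reindex_esum [set: T] [set: T'] e)//; rewrite setTT_bijective.
Qed.

Lemma summ_reindex T T' (e : T -> T') (f : T' -> R) :
  bijective e -> summ (f \o e) <-> summ f.
Proof.
by move=> be; rewrite /summ (reindex_esum [set: T] [set: T'] e)//; rewrite setTT_bijective.
Qed.

Lemma tonelli_summ T T' (g : T * T' -> R) (h : T -> R) :
  (forall x, 0 <= g x) ->
  (forall i, (\esum_(j in [set: T']) (g (i, j))%:E <= (h i)%:E)%E) ->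
  summ h -> summ g.
Proof.
move=> g0 gh sh; apply: summ_esum => //.
rewrite (_ : [set: T * T'] = [set: T] `*`` (fun=> [set: T']))//; last first.
  by apply/seteqP; split.
have := @esum_esum R T T' [set: T] (fun=> [set: T']) (fun i j => (g (i, j))%:E).
move=> H; under eq_esum do rewrite [X in g X]surjective_pairing.
rewrite -H; last by move=> *; rewrite lee_fin.
apply: le_lt_trans sh; apply: le_esum => i _.
by rewrite (le_trans (gh i))// lee_fin ler_norm.
Qed.

Lemma summ_prod T T' (f : T -> R) (g : T' -> R) : summ f -> summ g ->
  summ (fun p => f p.1 * g p.2).
Proof.
move=> sf sg.
apply: (@summ_le _ _ (fun p => `|f p.1| * `|g p.2|)).
  by move=> x; rewrite normrM.
apply: (@tonelli_summ _ _ _ (fun i => nsum (fun x => `|g x|) * `|f i|)).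
- by move=> x; rewrite mulr_ge0.
- move=> i /=; rewrite -nsumE; [|by move=> ?; rewrite mulr_ge0|by apply/summZ/summ_norm].
  rewrite lee_fin -tsum_nsum; last by move=> ?; rewrite mulr_ge0.
  rewrite tsumZ; last exact/summ_norm.
  by rewrite tsum_nsum// mulrC.
- exact/summZ/summ_norm.
Qed.

Lemma fubini_nsum T T' (g : T * T' -> R) : (forall x, 0 <= g x) -> summ g ->
  [/\ forall i, summ (fun j => g (i, j)), summ (fun i => nsum (fun j => g (i, j))) &
   nsum g = nsum (fun i => nsum (fun j => g (i, j)))].
Proof.
move=> g0 sg.
have E : (\esum_(i in [set: T]) \esum_(j in [set: T']) (g (i, j))%:E = (nsum g)%:E)%E.
  rewrite nsumE// (@esum_esum R T T' [set: T] (fun=> [set: T']) (fun i j => (g (i, j))%:E)).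
    rewrite (_ : [set: T * T'] = [set: T] `*`` (fun=> [set: T']))//; last first.
      by apply/seteqP; split.
    by apply: eq_esum => -[].
  by move=> *; rewrite lee_fin.
have s1 i : summ (fun j => g (i, j)).
  apply: summ_esum => //.
  apply: (@le_lt_trans _ _ (nsum g)%:E); last exact: ltry.
  rewrite -E (esumID [set i]); last by move=> *; apply: esum_ge0 => *; rewrite lee_fin.
  rewrite setTI esum_set1; last by apply: esum_ge0 => *; rewrite lee_fin.
  rewrite leeDl//; apply: esum_ge0 => *; apply: esum_ge0 => *; by rewrite lee_fin.
have E2 : (\esum_(i in [set: T]) (nsum (fun j => g (i, j)))%:E = (nsum g)%:E)%E.
  by rewrite -E; apply: eq_esum => i _; rewrite nsumE.
have s2 : summ (fun i => nsum (fun j => g (i, j))).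
  by apply: summ_esum; [move=> i; exact: nsum_ge0|rewrite E2 ltry].
by split=> //; apply: EFin_inj; rewrite -E2 nsumE// => i; exact: nsum_ge0.
Qed.

Lemma fubini_tsum T T' (f : T * T' -> R) : summ f ->
  tsum f = tsum (fun i => tsum (fun j => f (i, j))).
Proof.
move=> sf.
have [a1 a2 a3] := fubini_nsum (fun=> max0_ge0 _) (summ_pos sf).
have [b1 b2 b3] := fubini_nsum (fun=> max0_ge0 _) (summ_neg sf).
rewrite {1}/tsum a3 b3 -tsum_sub//.
- by move=> i; apply: nsum_ge0.
- by move=> i; apply: nsum_ge0.
Qed.

Lemma summ_tsum T T' (f : T * T' -> R) : summ f ->
  summ (fun i => tsum (fun j => f (i, j))).
Proof.
move=> sf; have [s1 s2 _] := fubini_nsum (fun p => normr_ge0 (f p)) (summ_norm sf).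
apply: summ_le s2 => i; rewrite -tsum_nsum//; apply: norm_tsum.
by apply: summ_le (s1 i) => j.
Qed.

Lemma swap_bij T T' : bijective (fun p : T' * T => (p.2, p.1)).
Proof. by exists (fun p => (p.2, p.1)) => -[]. Qed.

Lemma summ_tsumC T T' (f : T * T' -> R) : summ f ->
  summ (fun j => tsum (fun i => f (i, j))).
Proof. by move=> /(summ_reindex f (@swap_bij T T'))/summ_tsum. Qed.

Lemma fubini_tsumC T T' (f : T * T' -> R) : summ f ->
  tsum f = tsum (fun j => tsum (fun i => f (i, j))).
Proof.
move=> sf; rewrite (tsum_reindex _ (@swap_bij T T')) fubini_tsum//.
exact/(summ_reindex f (@swap_bij T T')).
Qed.

Lemma summ_fset T (A : {fset T}) (f : T -> R) :
  (forall x, x \notin A -> f x = 0) -> summ f.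
Proof.
move=> fA; rewrite /summ (_ : esum _ _ = \esum_(x in [set` A]) `|f x|%:E)%E.
  rewrite esum_fset//.
  by rewrite fsbig_finite// sumEFin ltry.
rewrite [RHS]esum_mkcond; apply: eq_esum => x _.
by case: ifPn => //; rewrite mem_setE => /fA ->; rewrite normr0.
Qed.

Lemma tsum_fset T (A : {fset T}) (f : T -> R) :
  (forall x, x \notin A -> f x = 0) -> tsum f = \sum_(x <- A) f x.
Proof.
move=> fA.
have pos (g : T -> R) : (forall x, 0 <= g x) -> (forall x, x \notin A -> g x = 0) ->
    nsum g = \sum_(x <- A) g x.
  move=> g0 gA; apply: EFin_inj; rewrite nsumE//; last exact: summ_fset gA.
  rewrite (_ : esum _ _ = \esum_(x in [set` A]) (g x)%:E)%E.
    rewrite esum_fset//; last by move=> *; rewrite lee_fin.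
    by rewrite fsbig_finite// sumEFin set_fsetK.
  rewrite [RHS]esum_mkcond; apply: eq_esum => x _.
  by case: ifPn => //; rewrite mem_setE => /gA ->.
rewrite /tsum !pos//; try by move=> x /fA ->; rewrite ?oppr0 maxxx.
by rewrite -sumrB; apply: eq_bigr => x _; rewrite -max_subE.
Qed.

Lemma tsum_ord T n (e : 'I_n -> T) (f : T -> R) : injective e ->
  (forall x, (forall i, x != e i) -> f x = 0) ->
  tsum f = \sum_(i < n) f (e i).
Proof.
move=> ie fe; rewrite (@tsum_fset _ [fset e i | i in 'I_n]%fset).
  by rewrite big_imfset /=; [rewrite big_enum|move=> i j _ _; exact: ie].
move=> x /imfsetP xA; apply: fe => i; apply/eqP => xi; apply: xA.
by exists i.
Qed.

Lemma tsum_inj T T' (e : T -> T') (f : T' -> R) : injective e ->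
  (forall x, (forall i, x <> e i) -> f x = 0) -> tsum f = tsum (f \o e).
Proof.
move=> ie fe.
have pos (g : T' -> R) : (forall x, (forall i, x <> e i) -> g x = 0) ->
    nsum g = nsum (g \o e).
  move=> ge; rewrite /nsum -(esum_image [set: T] e (fun x => (g x)%:E)); last first.
    by move=> x y _ _; exact: ie.
  congr fine; rewrite [RHS]esum_mkcond; apply: eq_esum => x _; case: ifPn => //.
  by rewrite notin_setE => H; rewrite ge// => i xi; apply: H; exists i.
by rewrite /tsum !pos// => x /fe ->; rewrite ?oppr0 maxxx.
Qed.

Lemma le_nsum1 T (f : T -> R) x : (forall x, 0 <= f x) -> summ f -> f x <= nsum f.
Proof.
move=> f0 sf; pose g y := if y == x then f x else 0.
have g0 y : 0 <= g y by rewrite /g; case: ifP.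
have -> : f x = nsum g.
  rewrite -tsum_nsum// (@tsum_fset _ [fset x]%fset) ?big_seq_fset1 /g ?eqxx// => y.
  by rewrite inE => /negbTE ->.
by apply: le_nsum => // y; rewrite /g; case: eqP => [->|].
Qed.

(** Turns a cardinality bound into a bound on a sum of indicators. Since [counting] is infinite on
    infinite sets, a real bound forces [A] to be finite. *)
Lemma summ_counting T T' (e : T -> T') (P : pred T) (A : set T') (M : R) :
  injective e -> e @` [set x | P x] = A -> (counting A <= M%:E)%E ->
  let f := fun x => if P x then 1 else 0 in summ f /\ nsum f <= M.
Proof.
move=> ie <- cM f.
have f0 x : 0 <= f x by rewrite /f; case: ifP.
have E : (\esum_(x in [set: T]) (f x)%:E = counting (e @` [set x | P x]))%E.
  rewrite /counting; case: asboolP => [fin|nfin]; last first.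
    by move: cM; rewrite /counting; case: asboolP.
  transitivity (\esum_(y in e @` [set x | P x]) (1 : \bar R))%E.
    rewrite esum_image; last by move=> ? ? _ _; exact: ie.
    rewrite [RHS]esum_mkcond; apply: eq_esum => x _; rewrite /f.
    have -> : (x \in [set x | P x]) = P x by apply/idP/idP; rewrite inE.
    by case: ifP.
  rewrite -[X in esum X _]set_mem_set esum_fset ?set_mem_set//.
  rewrite fsbig_finite ?set_mem_set//= big_const_seq count_predT.
  by elim: (size _) => //= m ->; rewrite -EFinD -natr1 addrC.
have sf : summ f by apply: summ_esum => //; rewrite E; exact: le_lt_trans cM (ltry _).
by split=> //; rewrite -lee_fin nsumE// E.
Qed.

Lemma nsum_tail T (g : T -> R) (e : R) : (forall x, 0 <= g x) -> summ g -> 0 < e ->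
  exists A : {fset T}, tsum (fun x => if x \in A then 0 else g x) <= e.
Proof.
move=> g0 sg e0.
have gfin : (\esum_(x in [set: T]) (g x)%:E)%E \is a fin_num by rewrite -nsumE.
have [_ [A [finA _] <-] hA] := @ub_ereal_sup_adherent R _ e e0 gfin.
exists (fset_set A).
have in0 x : 0 <= (if x \in fset_set A then 0 else g x) by case: ifP.
have in1 x : 0 <= (if x \in fset_set A then g x else 0) by case: ifP.
have s0 : summ (fun x => if x \in fset_set A then 0 else g x).
  by apply: (summ_le _ sg) => x; case: ifP; rewrite ?normr0// ger0_norm.
have s1 : summ (fun x => if x \in fset_set A then g x else 0).
  by apply: (summ_le _ sg) => x; case: ifP; rewrite ?normr0// ger0_norm.
rewrite -(lerD2l (tsum (fun x => if x \in fset_set A then g x else 0))) -tsumD//.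
under eq_tsum do rewrite (fun_if (fun u => u + _)).
rewrite (_ : (fun x => _) = g); last first.
  by apply: funext => x; case: (x \in _); rewrite ?addr0 ?add0r.
rewrite (@tsum_fset _ (fset_set A) (fun x => if x \in fset_set A then g x else 0)); last first.
  by move=> x /negbTE ->.
rewrite tsum_nsum// -lee_fin EFinD nsumE//.
have : (\esum_(x in [set: T]) (g x)%:E - e%:E <= (\sum_(x <- fset_set A) g x)%:E)%E.
  by move: (ltW hA); rewrite fsbig_finite//= sumEFin.
rewrite leeBlDr//.
by under [X in _ -> (_ <= X%:E + _)%E]eq_big_seq => x xA do rewrite xA.
Qed.

(** Take a finite [A] outside which [g] has sum at most e/4. Outside [A] the difference is at most 2
    g, which costs e/2; on [A] pointwise convergence gives e/4, shared equally among the points. *)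
Lemma tannery T (f : nat -> T -> R) (h g : T -> R) : summ g ->
  (\forall N \near \oo, forall x, `|f N x| <= g x) ->
  (forall x, f N x @[N --> \oo] --> h x) ->
  tsum (f N) @[N --> \oo] --> tsum h.
Proof.
move=> sg fg fh.
have g0 x : 0 <= g x by near \oo => N; apply: le_trans (near fg N _ x).
have hg x : `|h x| <= g x.
  apply: (ler_cvg_to (cvg_norm (fh x)) (cvg_cst (g x))).
  by apply: filterS fg.
have sh : summ h by exact: summ_le sg.
apply/cvgrPdist_le => e'; move: (e' : R) => {e'}e e0.
have e4 : 0 < e / 4 by rewrite divr_gt0.
have [A hA] := nsum_tail g0 sg e4.
have finA : \forall N \near \oo, forall x, x \in A ->
    `|h x - f N x| <= e / 4 / (#|` A |.+1)%:R.
  have := fun x => (iffLR (cvgrPdist_le _ _) (fh x)) (e / 4 / (#|` A|.+1)%:R).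
  move=> H; have {}H x : \forall N \near \oo, `|h x - f N x| <= e / 4 / (#|` A |.+1)%:R.
    by apply: H; rewrite divr_gt0.
  have := @filter_forall _ A (fun a N => `|h (val a) - f N (val a)| <= e / 4 / (#|` A |.+1)%:R) _ _ (fun a => H (val a)).
  by move=> /(_ _); apply: filterS => N HN x xA; exact: (HN [` xA]%fset).
near=> N.
have fgN x : `|f N x| <= g x by move: x; near: N.
have fAN x : x \in A -> `|h x - f N x| <= e / 4 / (#|` A |.+1)%:R by move: x; near: N.
have sfN : summ (f N) by exact: summ_le sg.
have sd : summ (fun x => h x - f N x) by apply: summD => //; exact: summN.
rewrite -tsumN -tsumD//; last exact: summN.
apply: (le_trans (norm_tsum sd)).
have s0 : summ (fun x => if x \in A then 0 else g x).
  by apply: (summ_le _ sg) => x; case: ifP; rewrite ?normr0// ger0_norm.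
pose k x := if x \in A then e / 4 / (#|` A |.+1)%:R else 0.
have sk : summ k by apply: (@summ_fset _ A) => x; rewrite /k => /negbTE ->.
apply: (@le_trans _ _ (tsum (fun x => k x + 2 * (if x \in A then 0 else g x)))).
  apply: le_tsum => [x||]; [|exact: summ_norm|by apply: summD => //; exact: summZ].
  rewrite /k; case: ifPn => [/fAN|_]; first by rewrite mulr0 addr0.
  rewrite add0r (le_trans (ler_normB _ _))//.
  by rewrite mulr_natl mulr2n lerD.
rewrite tsumD//; last exact: summZ.
rewrite tsumZ// (@tsum_fset _ A k); last by move=> x; rewrite /k => /negbTE ->.
under eq_big_seq => x xA do rewrite /k xA.
rewrite big_const_seq count_predT iter_addr addr0.
have : e / 4 / (#|` A |.+1)%:R *+ size A <= e / 4.
  rewrite -mulr_natr -mulrA; apply: ler_piMr; first exact: ltW.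
  by rewrite ler_pdivrMl// mulr1 ler_nat leqnSn.
have aux (a b : R) : b <= e / 4 -> a <= e / 4 -> a + 2 * b <= e by lra.
exact: aux hA.
Unshelve. all: by end_near.
Qed.

End Tsum.

(** * A trigonometric identity of Polya *)

Section Polya.
Variable R : realType.

Lemma cos_periodic_int (x : R) (k : int) : cos (x + 2 * pi * k%:~R) = cos x.
Proof.
have nat_case (y : R) (n : nat) : cos (y + 2 * pi * n%:R) = cos y.
  have -> : 2 * pi * n%:R = (pi *+ 2) *+ n :> R by rewrite -mulr_natr -(mulr_natr pi); ring.
  exact: (periodicn (@cosD2pi R)).
case: k => n; first exact: nat_case.
rewrite NegzE mulrNz mulrN -(nat_case (x - 2 * pi * n.+1%:R) n.+1).
by rewrite subrK.
Qed.

Lemma cosM2 (y z : R) : 2 * cos y * cos z = cos (z + y) + cos (z - y).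
Proof. by rewrite cosD cosB; ring. Qed.

(** Real part of the binomial expansion of (e^(iy) + e^(-iy))^M e^(iz); the induction is Pascal's
    rule. *)
Lemma cosX_sum (M : nat) (y z : R) :
  (2 * cos y) ^+ M * cos z =
  \sum_(i < M.+1) 'C(M, i)%:R * cos (z + (2 * i%:R - M%:R) * y).
Proof.
elim: M z => [|M IH] z.
  by rewrite big_ord1 expr0 bin0 !mul1r mulr0 subr0 mul0r addr0.
rewrite exprSr -mulrA cosM2 mulrDr !IH.
set g := fun i : nat => cos (z + (2 * i%:R - M.+1%:R) * y).
have -> : \sum_(i < M.+1) 'C(M, i)%:R * cos (z + y + (2 * i%:R - M%:R) * y) =
    \sum_(i < M.+1) 'C(M, i)%:R * g i.+1.
  by apply: eq_bigr => i _; congr (_ * cos _); rewrite -!natr1; ring.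
have -> : \sum_(i < M.+1) 'C(M, i)%:R * cos (z - y + (2 * i%:R - M%:R) * y) =
    \sum_(i < M.+1) 'C(M, i)%:R * g i.
  by apply: eq_bigr => i _; congr (_ * cos _); rewrite -!natr1; ring.
rewrite [RHS]big_ord_recl /=.
under [in RHS]eq_bigr do rewrite /bump /= add1n binS natrD mulrDl.
rewrite big_split /= [RHS]addrA [RHS]addrC; congr (_ + _).
have := @big_ord_recl R 0 +%R M.+1 (fun i : 'I_M.+2 => 'C(M, i)%:R * g i).
by rewrite big_ord_recr /= bin_small// mul0r addr0 !bin0.
Qed.

(* Orthogonality of the characters of Z/l, evaluated at shifted points. *)
Lemma cos_sum_residue (l : nat) (k : int) (t phi : R) : (0 < l)%N ->
  \sum_(j < l) cos (2 * pi * k%:~R * (j%:R + t) / l%:R + phi) =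
  if (l %| k)%Z then l%:R * cos (2 * pi * (k %/ l)%Z%:~R * t + phi) else 0.
Proof.
move=> l0; have l0' : (l%:R : R) != 0 by rewrite pnatr_eq0 -lt0n.
set q := (k %/ l)%Z; set r := (k %% l)%Z.
have kE : k%:~R = q%:~R * l%:R + r%:~R :> R.
  by rewrite {1}(divz_eq k l) intrD intrM.
have step j : cos (2 * pi * k%:~R * (j%:R + t) / l%:R + phi) =
    cos (2 * pi * r%:~R * (j%:R + t) / l%:R + (2 * pi * q%:~R * t + phi)).
  rewrite -[RHS](cos_periodic_int _ (q * Posz j)) intrM kE; congr cos.
  by field.
under eq_bigr do rewrite step.
have -> : (l %| k)%Z = (r == 0) by apply/idP/eqP => [/dvdz_mod0P|/dvdz_mod0P].
case: eqP => [->|/eqP r0].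
  under eq_bigr do rewrite mulr0 !mul0r add0r.
  by rewrite big_const_ord iter_addr_0 -[LHS]mulr_natl.
set psi := _ + phi.
have r_ge0 : (0 <= r) by rewrite modz_ge0// -lt0n.
have r_lt : r < l by rewrite ltz_pmod.
have s0 : sin (pi * r%:~R / l%:R) != 0 :> R.
  rewrite gt_eqF// sin_gt0_pi//; apply/andP; split.
    by rewrite divr_gt0 ?ltr0n// mulr_gt0 ?pi_gt0// ltr0z lt_def r0.
  rewrite ltr_pdivrMr ?ltr0n// ltr_pM2l ?pi_gt0//.
  by rewrite -[l%:R]/((Posz l)%:~R) ltr_int.
(* The angles form an arithmetic progression, so multiplying by twice the sine of half its step
   makes the sum telescope. The factor is nonzero because 0 < r < l, and the two end values differ
   by r full turns. *)
apply: (mulfI (x := 2 * sin (pi * r%:~R / l%:R))).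
  by rewrite mulf_neq0// pnatr_eq0.
rewrite mulr0 mulr_sumr.
pose F (j : nat) := sin (2 * pi * r%:~R * (j%:R + t) / l%:R + psi - pi * r%:~R / l%:R).
have tel j : 2 * sin (pi * r%:~R / l%:R) *
    cos (2 * pi * r%:~R * (j%:R + t) / l%:R + psi) = F j.+1 - F j.
  have -> : F j.+1 = sin (2 * pi * r%:~R * (j%:R + t) / l%:R + psi + pi * r%:~R / l%:R).
    by rewrite /F -natr1; congr sin; field.
  by rewrite /F sinD sinB; ring.
under eq_bigr do rewrite tel.
rewrite -(big_mkord xpredT (fun j => F j.+1 - F j)) telescope_sumr//.
rewrite /F -!cosBpihalf; apply/eqP; rewrite subr_eq0; apply/eqP.
rewrite -[RHS](cos_periodic_int _ r); congr cos.
by field.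
Qed.

(** Binomial coefficient at signed distance d from the centre, divided by the central one: a
    discrete Gaussian with value 1 at 0. The absolute value uses the symmetry of the row to stay
    within nat. *)
Definition binr (m : nat) (d : int) : R := 'C(m.*2, m + `|d|)%:R / 'C(m.*2, m)%:R.

Lemma bin_central_neq0 m : 'C(m.*2, m)%:R != 0 :> R.
Proof. by rewrite pnatr_eq0 -lt0n bin_gt0 -addnn leq_addr. Qed.

Lemma binr_ord m (i : 'I_(m.*2.+1)) :
  'C(m.*2, i)%:R = 'C(m.*2, m)%:R * binr m (Posz i - Posz m).
Proof.
rewrite /binr mulrC divfK ?bin_central_neq0//; congr (_%:R).
have [le_mi|lt_im] := leqP m i.
  by rewrite (_ : m + _ = i)%N //; lia.
rewrite (_ : m + _ = m.*2 - i)%N ?bin_sub//; have := ltn_ord i; lia.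
Qed.

Lemma binr_out m d : (m < `|d|)%N -> binr m d = 0.
Proof. by move=> h; rewrite /binr bin_small ?mul0r// -addnn ltn_add2l. Qed.

(* Summing (2 cos y)^(2m) e^(2ipy), expanded by the binomial theorem, over the
   points y = pi (j + t) / l with j in a residue system modulo l = 2h + 1
   keeps the frequencies divisible by l.  With m ~ a l^2 / pi and p ~ u l the
   two sides tend to the two sides of the Poisson formula for Gaussians; the
   phase phi replaces complex exponentials. *)
Definition polyaL (h m : nat) (p : int) (t phi : R) (j : int) : R :=
  if (`|j| <= h)%N then
    cos (pi * (j%:~R + t) / (h.*2.+1)%:R) ^+ m.*2 *
    cos (2 * pi * p%:~R * (j%:~R + t) / (h.*2.+1)%:R + phi)
  else 0.

Definition polyaR (h m : nat) (p : int) (t phi : R) (k : int) : R :=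
  binr m (Posz h.*2.+1 * k - p) * cos (2 * pi * k%:~R * t + phi).

Lemma polya h m p t phi :
  tsum (polyaL h m p t phi) =
  (h.*2.+1)%:R * ('C(m.*2, m)%:R / 4 ^+ m) * tsum (polyaR h m p t phi).
Proof.
set l := h.*2.+1.
have l0 : (l%:R : R) != 0 by rewrite pnatr_eq0.
(* The symmetric residues -h, ..., h become 0, ..., 2h at the price of replacing t by t - h. *)
have -> : tsum (polyaL h m p t phi) = \sum_(j < l)
   cos (pi * (j%:R + (t - h%:R)) / l%:R) ^+ m.*2 *
   cos (2 * pi * p%:~R * (j%:R + (t - h%:R)) / l%:R + phi).
  rewrite (@tsum_ord _ _ l (fun j : 'I_l => Posz j - Posz h)).
  - apply: eq_bigr => j _; rewrite /polyaL ifT; last first.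
      by have := ltn_ord j; rewrite /l; lia.
    rewrite intrB /=.
    by congr (cos _ ^+ _ * cos _); ring.
  - move=> i j /= ij; apply: val_inj => /=; lia.
  - move=> /= x hx; rewrite /polyaL; case: ifPn => // xh.
    have xl : (absz (x + Posz h)%R < l)%N by rewrite /l; lia.
    have := hx (Ordinal xl); case/eqP => /=; lia.
have E (j : 'I_l) : 4 ^+ m * cos (pi * (j%:R + (t - h%:R)) / l%:R) ^+ m.*2 *
    cos (2 * pi * p%:~R * (j%:R + (t - h%:R)) / l%:R + phi) =
    \sum_(i < m.*2.+1) 'C(m.*2, i)%:R *
      cos (2 * pi * p%:~R * (j%:R + (t - h%:R)) / l%:R + phi +
         (2 * i%:R - m.*2%:R) * (pi * (j%:R + (t - h%:R)) / l%:R)).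
  rewrite -cosX_sum exprMn; congr (_ * _ * _).
  by rewrite -mul2n exprM; congr (_ ^+ _); ring.
apply: (mulfI (x := 4 ^+ m)); first by rewrite expf_neq0// pnatr_eq0.
rewrite mulr_sumr; under eq_bigr do rewrite mulrA E.
rewrite exchange_big /=.
transitivity (\sum_(i < m.*2.+1) 'C(m.*2, i)%:R *
   (if (l %| Posz i - Posz m + p)%Z then
     l%:R * cos (2 * pi * ((Posz i - Posz m + p) %/ l)%Z%:~R * t + phi) else 0)).
  apply: eq_bigr => i _; rewrite -mulr_sumr; congr (_ * _).
  transitivity (\sum_(j < l) cos (2 * pi * (Posz i - Posz m + p)%:~R *
      (j%:R + (t - h%:R)) / l%:R + phi)).
    apply: eq_bigr => j _; congr cos; rewrite intrD intrB /=.
    have -> : m.*2%:R = 2 * m%:R :> R by rewrite -mul2n natrM.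
    by field.
  rewrite cos_sum_residue//; case: ifP => // _; congr (_ * _).
  (* Undoes the replacement of t by t - h: the shift is an integer, hence changes the angle by full
     turns. *)
  rewrite -[RHS](cos_periodic_int _ (- ((Posz i - Posz m + p) %/ l)%Z * Posz h)).
  by congr cos; rewrite intrM rmorphN /=; ring.
(* The surviving frequencies d are those of the form l k - p; extended by zero to all integers, the
   sum can be indexed by k on one side and by the binomial index on the other. *)
pose G (d : int) : R := binr m d * (if (l %| d + p)%Z then
     cos (2 * pi * ((d + p) %/ l)%Z%:~R * t + phi) else 0).
have -> : tsum (polyaR h m p t phi) = tsum G.
  rewrite (@tsum_inj _ _ _ (fun k : int => Posz l * k - p) G).
  - apply: eq_tsum => k; rewrite /polyaR /G /= subrK dvdz_mulr ?dvdzz//.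
    by rewrite mulKz.
  - by move=> x y /(congr1 (fun z => z + p)); rewrite !subrK => /mulfI; apply.
  - move=> x hx; rewrite /G; case: ifPn; rewrite ?mulr0// => /dvdzP[k xk].
    by case: (hx k); rewrite mulrC -xk addrK.
rewrite (@tsum_ord _ _ m.*2.+1 (fun i : 'I_(m.*2.+1) => Posz i - Posz m) G).
- rewrite !mulr_sumr; apply: eq_bigr => i _; rewrite /G binr_ord.
  have h4 : (4 : R) ^+ m != 0 by rewrite expf_neq0// pnatr_eq0.
  by case: ifP => _; [field|rewrite !mulr0].
- by move=> i j /= ij; apply: val_inj => /=; lia.
- move=> /= x hx; rewrite /G; have [xm|mx] := leqP `|x|%N m; last first.
    by rewrite binr_out ?mul0r.
  have xl : (absz (x + Posz m)%R < m.*2.+1)%N by lia.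
  by have := hx (Ordinal xl); case/eqP => /=; lia.
Qed.

End Polya.

(** * Elementary estimates *)

Section Bounds.
Variable R : realType.

Lemma binr_ge0 m d : 0 <= binr R m d.
Proof. by rewrite divr_ge0. Qed.

Lemma binrS m (d : nat) : (d <= m)%N ->
  binr R m (Posz d.+1) * (m + d).+1%:R = binr R m (Posz d) * (m%:R - d%:R).
Proof.
move=> dm; rewrite /binr /= addnS -!mulrA ![_^-1 * _]mulrC !mulrA; congr (_ / _).
rewrite -natrB// -!natrM mulnC mul_bin_left mulnC.
by congr (_ * _)%:R; lia.
Qed.

Lemma binr0 m : binr R m 0 = 1.
Proof. by rewrite /binr /= addn0 divff// bin_central_neq0. Qed.

(** Consecutive values have ratio (m - d) / (m + d + 1) = 1 - (2d + 1) / (m + d + 1), at most exp(-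
    (2d + 1) / (m + D)) when d < D, and the odd numbers add up to d^2. Fixing [D] keeps the
    denominator constant during the induction. *)
Lemma binr_le (m D d : nat) : (0 < m)%N -> (d <= D)%N ->
  binr R m (Posz d) <= expR (- (d%:R ^+ 2 / (m%:R + D%:R))).
Proof.
move=> m0; elim: d => [|d IH] dD; first by rewrite binr0 expr0n mul0r oppr0 expR0.
have [md|dm] := leqP m d.
  by rewrite binr_out ?expR_ge0//=; lia.
have dm' := ltnW dm.
have pos : 0 < (m + d).+1%:R :> R by rewrite ltr0n.
rewrite -(ler_pM2r pos) binrS//.
have q0 : 0 < (m%:R + D%:R : R) by rewrite -natrD ltr0n; lia.
have -> : expR (- (d.+1%:R ^+ 2 / (m%:R + D%:R))) =
   expR (- (d%:R ^+ 2 / (m%:R + D%:R))) * expR (- ((2 * d%:R + 1) / (m%:R + D%:R))) :> R.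
  by rewrite -expRD; congr expR; rewrite -natr1; field; lra.
rewrite -[leRHS]mulrA; apply: ler_pM (IH (ltnW dD)) _; first exact: binr_ge0.
  by rewrite subr_ge0 ler_nat.
have h := expR_ge1Dx (- ((2 * d%:R + 1) / (m%:R + D%:R)) : R).
apply: le_trans (ler_wpM2r (ltW pos) h).
have -> : (m + d).+1%:R = m%:R + d%:R + 1 :> R by rewrite -natr1 natrD.
have Dd : d%:R + 1 <= D%:R :> R by rewrite natr1 ler_nat.
have d0 : 0 <= d%:R :> R by [].
have mm : 0 < m%:R :> R by rewrite ltr0n.
rewrite mulrDl mul1r mulNr -lerBlDl lerNr mulrAC ler_pdivrMr//.
nra.
Qed.

(** Same product, with the inverse ratio 1 + (2d + 1) / (m - d) bounded above by an exponential. *)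
Lemma binr_ge (m D d : nat) : (D < m)%N -> (d <= D)%N ->
  expR (- (d%:R ^+ 2 / (m%:R - D%:R))) <= binr R m (Posz d).
Proof.
move=> Dm; elim: d => [|d IH] dD; first by rewrite binr0 expr0n mul0r oppr0 expR0.
have pos : 0 < (m + d).+1%:R :> R by rewrite ltr0n.
rewrite -(ler_pM2r pos) binrS//; last by lia.
have Dm' : D%:R + 1 <= m%:R :> R by rewrite natr1 ler_nat.
have Dd : d%:R + 1 <= D%:R :> R by rewrite natr1 ler_nat.
have d0 : 0 <= d%:R :> R by [].
have -> : expR (- (d.+1%:R ^+ 2 / (m%:R - D%:R))) =
   expR (- (d%:R ^+ 2 / (m%:R - D%:R))) * expR (- ((2 * d%:R + 1) / (m%:R - D%:R))) :> R.
  by rewrite -expRD; congr expR; rewrite -natr1; field; lra.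
rewrite -[leLHS]mulrA; apply: ler_pM (IH (ltnW dD)) _; first exact: expR_ge0.
  by rewrite mulr_ge0 ?expR_ge0.
rewrite expRN mulrC ler_pdivrMr ?expR_gt0//.
have h := expR_ge1Dx ((2 * d%:R + 1) / (m%:R - D%:R) : R).
have md0 : 0 <= m%:R - d%:R :> R by lra.
apply: le_trans (ler_wpM2l md0 h).
have -> : (m + d).+1%:R = m%:R + d%:R + 1 :> R by rewrite -natr1 natrD.
rewrite mulrDr mulr1 -lerBlDl mulrA ler_pdivlMr; last by lra.
nra.
Qed.

Lemma sin_mvt (y : R) : 0 <= y -> exists2 x, 0 <= x <= y & sin y = y * cos x.
Proof.
move=> y0; have [x] := @MVT_segment R sin cos 0 y y0
  (fun x _ => is_derive_sin x) (continuous_subspaceT (@continuous_sin R)).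
by rewrite in_itv /= sin0 !subr0 => xy ->; exists x; rewrite // mulrC.
Qed.

Lemma cos_ge_half (x : R) : 0 <= x <= pi / 4 -> 1 / 2 <= cos x.
Proof.
move=> /andP[x0 xp]; have p0 := pi_gt0 R.
have h : cos (pi / 4) ^+ 2 = 1 / 2 :> R.
  have := cos_pihalf R; have -> : pi / 2 = (pi / 4) *+ 2 :> R by rewrite -mulr_natr; field.
  by rewrite cos_mulr2n mulr2n; lra.
have c1 := cos_le1 (pi / 4 : R).
have c0 : 0 <= cos (pi / 4) :> R by apply: cos_ge0_pihalf; lra.
have : cos (pi / 4) <= cos x.
  move: xp; rewrite le_eqVlt => /orP[/eqP -> //|xp].
  by rewrite ltW// ltr_cos// in_itv /=; lra.
by apply: le_trans; nra.
Qed.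

(** Halving y brings the angle below pi / 4, where cosines are at least 1/2; then sin y = 2 sin(y/2)
    cos(y/2) >= y/4. The constant only has to give a summable majorant. *)
Lemma sin_sqr_ge (y : R) : `|y| <= pi / 2 -> y ^+ 2 / 16 <= sin y ^+ 2.
Proof.
wlog y0 : y / 0 <= y => [H yp|].
  have [/H|y0] := leP 0 y; first exact.
  by have := H (- y); rewrite normrN sinN !sqrrN; apply=> //; lra.
rewrite ger0_norm// => yp; have p0 := pi_gt0 R.
have y20 : 0 <= y / 2 by lra.
have [x /andP[x0 xy] sx] := @sin_mvt (y / 2) y20.
have cx : 1 / 2 <= cos x by apply: cos_ge_half; lra.
have cy : 1 / 2 <= cos (y / 2) by apply: cos_ge_half; lra.
have sy : sin y = 2 * (cos (y / 2) * (y / 2 * cos x)).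
  rewrite -sx {1}(_ : y = (y / 2) *+ 2); last by rewrite mulr2n; lra.
  by rewrite sin_mulr2n mulr2n; lra.
have : y / 4 <= sin y.
  have : 1 / 4 <= cos (y / 2) * cos x by nra.
  by rewrite sy; nra.
by move=> h; nra.
Qed.

Lemma sin_sqr_le (y : R) : sin y ^+ 2 <= y ^+ 2.
Proof.
wlog y0 : y / 0 <= y => [H|].
  have [/H//|y0] := leP 0 y.
  by have := H (- y); rewrite sinN !sqrrN; apply; lra.
have [x _ ->] := sin_mvt y0; rewrite exprMn.
have := cos_max x; rewrite -ler_sqr ?nnegrE// real_normK ?num_real// => h.
by have := sqr_ge0 y; nra.
Qed.

Lemma sin_sqr_ge_cos (y : R) : `|y| <= pi / 2 -> y ^+ 2 * cos y ^+ 2 <= sin y ^+ 2.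
Proof.
wlog y0 : y / 0 <= y => [H yp|].
  have [/H|y0] := leP 0 y; first exact.
  by have := H (- y); rewrite normrN sinN cosN !sqrrN; apply=> //; lra.
rewrite ger0_norm// => yp; have p0 := pi_gt0 R.
have [x /andP[x0 xy] ->] := sin_mvt y0; rewrite exprMn.
have cy : 0 <= cos y by apply: cos_ge0_pihalf; lra.
have : cos y <= cos x.
  move: xy; rewrite le_eqVlt => /orP[/eqP -> //|xy].
  by rewrite ltW// ltr_cos// in_itv /=; lra.
move=> h; rewrite ler_wpM2l ?sqr_ge0// lerXn2r ?nnegrE//.
exact: le_trans h.
Qed.

Lemma cos_double_le (y c : R) m : c <= sin y ^+ 2 -> cos y ^+ m.*2 <= expR (- (m%:R * c)).
Proof.
move=> h; rewrite -[X in expR X]mulrN expRM_natl -mul2n exprM cos2sin2 lerXn2r ?nnegrE ?expR_ge0//.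
by apply: le_trans (expR_ge1Dx _); lra.
Qed.

(** From 1 / cos^2 = 1 + sin^2 / cos^2 <= exp(y^2 / cos^2). Together with [cos_double_le] and
    [sin_sqr_ge_cos] this encloses cos^(2m) between Gaussians whose exponents differ by factors
    tending to 1 as y tends to 0. *)
Lemma cos_double_ge (y : R) m : cos y != 0 ->
  expR (- (m%:R * (y ^+ 2 / cos y ^+ 2))) <= cos y ^+ m.*2.
Proof.
move=> cy; have c0 : 0 < cos y ^+ 2 by rewrite exprn_even_gt0.
rewrite -[X in expR X]mulrN expRM_natl -mul2n exprM.
rewrite lerXn2r ?nnegrE ?expR_ge0//; first exact: ltW.
rewrite expRN -[leRHS]invrK lef_pV2 ?posrE ?expR_gt0 ?invr_gt0//.
apply: le_trans (expR_ge1Dx _).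
have h := sin_sqr_le y; have E := cos2Dsin2 y.
rewrite -[X in X <= _]mul1r ler_pdivrMr// mulrDl divfK ?gt_eqF//; lra.
Qed.

(** Completing the square gives c x^2 >= x - 1 / (4c). The resulting geometric majorant does not
    depend on t within the bound B, as dominated convergence and uniform estimates require. *)
Lemma expR_quadratic_le (c : R) (j : int) (t B : R) : 0 < c -> `|t| <= B ->
  expR (- (c * (j%:~R + t) ^+ 2)) <= expR (1 / (4 * c) + B) * expR (-1) ^+ `|j|%N.
Proof.
move=> c0 tB; rewrite -expRM_natr -expRD ler_expR.
have : `|j%:~R| - B <= `|j%:~R + t|.
  have := ler_normB (j%:~R + t) t; rewrite addrK; lra.
have -> : `|j%:~R| = (`|j|%N)%:R :> R by rewrite -intr_norm -abszE.
rewrite -(real_normK (num_real (j%:~R + t))); set x := `|_ + _|; set n := _%:R => h.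
have E : c * x ^+ 2 - x + 1 / (4 * c) = (2 * c * x - 1) ^+ 2 / (4 * c) by field; lra.
have : 0 <= (2 * c * x - 1) ^+ 2 / (4 * c) by rewrite divr_ge0 ?sqr_ge0//; lra.
rewrite -E; lra.
Qed.

Lemma geometric_nsum (r : R) : 0 <= r < 1 ->
  summ (fun n : nat => r ^+ n) /\ nsum (fun n : nat => r ^+ n) <= (1 - r)^-1.
Proof.
move=> /andP[r0 r1].
have le : (\esum_(n in [set: nat]) (r ^+ n)%:E <= ((1 - r)^-1)%:E)%E.
  rewrite -nneseries_esumT => [|n]; last by rewrite lee_fin exprn_ge0.
  apply: lime_le; first by apply: is_cvg_nneseries => n _ _; rewrite lee_fin exprn_ge0.
  near=> n; rewrite sumEFin lee_fin.
  have -> : \sum_(0 <= i < n) r ^+ i = (1 - r ^+ n) / (1 - r).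
    have r1' : 1 - r != 0 by rewrite gt_eqF// subr_gt0.
    apply: (mulIf r1'); rewrite divfK// -[RHS]opprB subrX1 big_mkord; ring.
  by rewrite ler_piMl ?invr_ge0; [| lra | rewrite gerBl exprn_ge0].
have s : summ (fun n : nat => r ^+ n).
  apply: summ_esum => [n|]; first exact: exprn_ge0.
  exact: le_lt_trans le (ltry _).
by split=> //; rewrite -lee_fin nsumE// => n; exact: exprn_ge0.
Unshelve. all: by end_near.
Qed.

Lemma summ_geometric_int (r : R) : 0 <= r < 1 -> summ (fun j : int => r ^+ `|j|%N).
Proof.
move=> r01; have [sn _] := geometric_nsum r01; move: r01 => /andP[r0 r1].
pose e (p : bool * nat) := if p.1 then Posz p.2 else Negz p.2.
have be : bijective e.
  exists (fun z : int => match z with Posz n => (true, n) | Negz n => (false, n) end).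
    by move=> [[] n].
  by case.
apply/(summ_reindex _ be).
have sb : summ (fun _ : bool => 1 : R).
  by apply: (@summ_fset _ _ [fset true; false]%fset) => -[]; rewrite !inE.
apply: (summ_le _ (summ_prod sb sn)) => -[b n] /=.
rewrite mul1r ger0_norm ?exprn_ge0// /e; case: b => //=.
by rewrite exprS ler_piMl ?exprn_ge0// ltW.
Qed.

End Bounds.

(** * Poisson summation for one-dimensional Gaussians *)

Section Poisson1.
Variable R : realType.

Definition centralr (m : nat) : R := 'C(m.*2, m)%:R / 4 ^+ m.

Lemma centralrS m : centralr m.+1 * (2 * m%:R + 2) = centralr m * (2 * m%:R + 1).
Proof.
have E : ('C(m.+1.*2, m.+1) * m.+1 * m.+1 = 'C(m.*2, m) * (m.*2.+1 * m.*2.+2))%N.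
  have /= e1 := mul_bin_diag m.*2.+2 m; have /= e2 := mul_bin_diag m.*2.+1 m.
  have e3 : ('C(m.*2.+1, m) = 'C(m.*2.+1, m.+1))%N.
    by rewrite -bin_sub; [congr 'C(_, _); lia|lia].
  rewrite e3 in e1; rewrite doubleS [('C(_, _) * _)%N]mulnC -e1 -mulnA [('C(_, _) * _)%N]mulnC -e2; lia.
have {}E : 'C(m.+1.*2, m.+1)%:R * (m%:R + 1) * (m%:R + 1) =
    'C(m.*2, m)%:R * ((2 * m%:R + 1) * (2 * m%:R + 2)) :> R.
  have := congr1 (fun n => n%:R : R) E; rewrite !natrM -[m.+1%:R]natr1 => ->.
  have d2 : m.*2%:R = 2 * m%:R :> R by rewrite -mul2n natrM.
  have -> : m.*2.+1%:R = 2 * m%:R + 1 :> R by rewrite -d2 natr1.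
  by have -> : m.*2.+2%:R = 2 * m%:R + 2 :> R by rewrite -d2 -natrD addn2.
have m0 : 0 <= m%:R :> R by [].
have p4 : 4 ^+ m != 0 :> R by rewrite expf_neq0// pnatr_eq0.
rewrite /centralr exprS.
have -> : 'C(m.+1.*2, m.+1)%:R = 'C(m.*2, m)%:R * ((2 * m%:R + 1) * (2 * m%:R + 2)) /
    (m%:R + 1) / (m%:R + 1) :> R by rewrite -E; field; lra.
by field; rewrite p4 /=; lra.
Qed.

Lemma centralr_gt0 m : 0 < centralr m.
Proof. by rewrite divr_gt0 ?exprn_gt0// ltr0n bin_gt0; lia. Qed.

(** The sequence n [centralr] n ^ 2 increases while (2n + 1) [centralr] n ^ 2 decreases from 1, so
    the former has a positive limit. *)
Lemma central_cvg : exists2 c : R, 0 < c &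
  Num.sqrt n%:R * centralr n @[n --> \oo] --> c.
Proof.
pose v n : R := n%:R * centralr n ^+ 2.
have vS n : centralr n.+1 = centralr n * (2 * n%:R + 1) / (2 * n%:R + 2).
  have n0 : 0 <= n%:R :> R by [].
  by rewrite -centralrS; field; lra.
have nd : nondecreasing_seq v.
  apply/nondecreasing_seqP => n; rewrite /v vS -natr1.
  have n0 : 0 <= n%:R :> R by [].
  have -> : (n%:R + 1) * (centralr n * (2 * n%:R + 1) / (2 * n%:R + 2)) ^+ 2 =
    n%:R * centralr n ^+ 2 + centralr n ^+ 2 / (4 * (n%:R + 1)) :> R by field; lra.
  by rewrite lerDl divr_ge0 ?sqr_ge0//; lra.
have bd n : (2 * n%:R + 1) * centralr n ^+ 2 <= 1.
  elim: n => [|n IH]; first by rewrite /centralr bin0 expr0 divr1 expr1n; lra.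
  apply: le_trans IH; rewrite vS -[n.+1%:R]natr1.
  have n0 : 0 <= n%:R :> R by [].
  rewrite -subr_ge0.
  have -> : (2 * n%:R + 1) * centralr n ^+ 2 - (2 * (n%:R + 1) + 1) *
     (centralr n * (2 * n%:R + 1) / (2 * n%:R + 2)) ^+ 2 =
     (2 * n%:R + 1) * centralr n ^+ 2 / (2 * n%:R + 2) ^+ 2 :> R by field; lra.
  by rewrite divr_ge0 ?sqr_ge0// mulr_ge0 ?sqr_ge0//; lra.
have vb n : v n <= 1.
  apply: le_trans (bd n); rewrite ler_wpM2r ?sqr_ge0//.
  have n0 : 0 <= n%:R :> R by []; lra.
have cv : cvgn v by apply: nondecreasing_is_cvgn => //; exists 1 => _ [n _ <-].
have v1 : 0 < limn v.
  apply: (@lt_le_trans _ _ (v 1%N)); last exact: nondecreasing_cvgn_le.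
  by rewrite /v mul1r exprn_gt0// centralr_gt0.
exists (Num.sqrt (limn v)); first by rewrite sqrtr_gt0.
have -> : (fun n => Num.sqrt n%:R * centralr n) = (fun n => Num.sqrt (v n)).
  by apply: funext => n; rewrite /v sqrtrM// sqrtr_sqr gtr0_norm// centralr_gt0.
by apply: continuous_cvg => //; exact: sqrt_continuous.
Qed.

Let l (N : nat) : R := (N.*2.+1)%:R.

Let l_gt0 N : 0 < l N. Proof. by rewrite ltr0n. Qed.

Let cvg_linv : (l N)^-1 @[N --> \oo] --> (0 : R).
Proof.
apply: (@squeeze_cvgr _ _ _ _ (fun=> 0) (fun N => (N.+1%:R)^-1)).
- near=> N; rewrite invr_ge0 ltW//= lef_pV2 ?posrE// ler_nat; lia.
- exact: cvg_cst.
- exact: cvg_harmonic.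
Unshelve. all: by end_near.
Qed.

Let cvg_of_dist (x : nat -> R) (c : R) : (forall N, `|c - x N| <= (l N)^-1) ->
  x N @[N --> \oo] --> c.
Proof.
move=> h; apply/cvgrPdist_le => e e0.
move/cvgrPdist_le: cvg_linv => /(_ e e0).
apply: filterS => N; rewrite sub0r normrN ger0_norm; last by rewrite invr_ge0 ltW.
exact: le_trans.
Qed.

Let cvg_sqr (f : nat -> R) (x : R) :
  f N @[N --> \oo] --> x -> f N ^+ 2 @[N --> \oo] --> x ^+ 2.
Proof. by move=> fx; rewrite expr2; under eq_cvg do rewrite expr2; exact: cvgM. Qed.

(** * The Gaussian limit of the trigonometric identity *)

Section Approximation.
Variables (a t u phi : R).
Hypotheses (a0 : 0 < a) (t2 : -1 <= 2 * t <= 1).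

Let mN N : nat := Num.truncn (a * l N ^+ 2 / pi).
Let pN N : int := Num.floor (u * l N).
Let r N : R := (mN N)%:R / l N ^+ 2.
Let q N : R := (pN N)%:~R / l N.

Let cvg_r : r N @[N --> \oo] --> a / pi.
Proof.
apply: cvg_of_dist => N.
have p0 := pi_gt0 R; have l0 := l_gt0 N.
have h0 : 0 <= a * l N ^+ 2 / pi by rewrite divr_ge0 ?mulr_ge0 ?sqr_ge0// ltW.
have /andP[h1 h2] := truncn_itv h0.
rewrite -/(mN N) -natr1 in h1 h2.
have E : a / pi - r N = (a * l N ^+ 2 / pi - (mN N)%:R) / l N ^+ 2.
  by rewrite /r; field; lra.
rewrite E ger0_norm; last by rewrite divr_ge0 ?sqr_ge0// subr_ge0.
have l1 : 1 <= l N by rewrite ler1n.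
rewrite ler_pdivrMr ?exprn_gt0// expr2 mulKf ?gt_eqF//; lra.
Qed.

Let cvg_q : q N @[N --> \oo] --> u.
Proof.
apply: cvg_of_dist => N; have l0 := l_gt0 N.
have /andP[h1 h2] := floor_itv (u * l N).
rewrite -/(pN N) intrD in h1 h2.
have E : u - q N = (u * l N - (pN N)%:~R) / l N by rewrite /q; field; lra.
rewrite E ger0_norm; last by rewrite divr_ge0 ?(ltW l0)// subr_ge0.
rewrite -[leRHS]mul1r ler_pM2r ?invr_gt0//; lra.
Qed.

Let api : 0 < a / pi. Proof. by rewrite divr_gt0// pi_gt0. Qed.

Let r_near : \forall N \near \oo, a / (2 * pi) <= r N <= 2 * a / pi.
Proof.
have p0 := pi_gt0 R.
have e0 : 0 < a / (2 * pi) by rewrite divr_gt0// mulr_gt0.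
move/cvgrPdist_le: cvg_r => /(_ _ e0).
apply: filterS => N; rewrite ler_norml => /andP[h1 h2].
have E : a / pi = 2 * (a / (2 * pi)) by field; lra.
have E2 : 2 * a / pi = 4 * (a / (2 * pi)) by field; lra.
rewrite E2; apply/andP; split; lra.
Qed.

Let mE N : (mN N)%:R = r N * l N ^+ 2.
Proof. by rewrite /r divfK// expf_neq0// gt_eqF. Qed.

(** With |t| <= 1/2 and |j| <= N, the distance |j + t| is at most N + 1/2, which is half of the
    modulus. So all sample points lie where the sine estimates apply. *)
Let argument_le N (j : int) : (`|j| <= N)%N -> `|pi * (j%:~R + t) * (l N)^-1| <= pi / 2.
Proof.
move=> jN; have p0 := pi_gt0 R; have l0 := l_gt0 N.
rewrite normrM normrM (gtr0_norm p0) (gtr0_norm (_ : 0 < (l N)^-1)) ?invr_gt0// ler_pdivrMr//.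
have : `|j%:~R + t| <= l N / 2.
  have jN' : `|j%:~R| <= N%:R :> R by rewrite -intr_norm -abszE ler_nat.
  apply: le_trans (ler_normD _ _) _.
  have tt : `|t| <= 1 / 2 by have ht := t2; rewrite ler_norml; lra.
  have -> : l N = 2 * N%:R + 1 by rewrite /l -[LHS]natr1 -mul2n natrM.
  lra.
by move=> h; have := ler_wpM2l (ltW p0) h; lra.
Qed.

Let cvg_polyaL (j : int) : polyaL N (mN N) (pN N) t phi j @[N --> \oo] -->
  expR (- (pi * a * (j%:~R + t) ^+ 2)) * cos (2 * pi * u * (j%:~R + t) + phi).
Proof.
have p0 := pi_gt0 R.
pose y N := pi * (j%:~R + t) * (l N)^-1.
have cy : y N @[N --> \oo] --> (0 : R).
  by rewrite -[X in _ --> X](mulr0 (pi * (j%:~R + t))); apply: cvgMl_tmp.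
have ccy : cos (y N) @[N --> \oo] --> (1 : R).
  by rewrite -(cos0 R); apply: continuous_cvg => //; exact: continuous_cos.
have big : \forall N \near \oo, (`|j| <= N)%N by exists `|j|%N.
have cL : cos (y N) ^+ (mN N).*2 @[N --> \oo] --> expR (- (pi * a * (j%:~R + t) ^+ 2)).
  have myE N : (mN N)%:R * y N ^+ 2 = r N * (pi ^+ 2 * (j%:~R + t) ^+ 2).
    by have l0 := l_gt0 N; rewrite mE /y; field; lra.
  have lim : r N * (pi ^+ 2 * (j%:~R + t) ^+ 2) @[N --> \oo] --> pi * a * (j%:~R + t) ^+ 2.
    have -> : pi * a * (j%:~R + t) ^+ 2 = a / pi * (pi ^+ 2 * (j%:~R + t) ^+ 2).
      by field; lra.
    by apply: cvgMr_tmp => //; exact: cvg_r.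
  (* Here m y^2 = r pi^2 (j + t)^2 has a limit and cos y tends to 1, so both bounds have the same
     limit. *)
  apply: (@squeeze_cvgr _ _ _ _
    (fun N => expR (- (r N * (pi ^+ 2 * (j%:~R + t) ^+ 2) / cos (y N) ^+ 2)))
    (fun N => expR (- (r N * (pi ^+ 2 * (j%:~R + t) ^+ 2) * cos (y N) ^+ 2)))).
  - near=> N; have cN : cos (y N) != 0.
      rewrite gt_eqF//; near: N; exact: (cvgr_gt _ ccy _ ltr01).
    rewrite -!myE -mulrA cos_double_ge//= -mulrA; apply: cos_double_le.
    apply: sin_sqr_ge_cos.
    by apply: argument_le; near: N.
  - apply: continuous_cvg; first exact: continuous_expR.
    apply: cvgN; rewrite -[X in _ --> X]divr1; apply: cvgM => //.
    apply: cvgV; first exact: oner_neq0.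
    by rewrite -(expr1n R 2); apply: cvg_sqr.
  - apply: continuous_cvg; first exact: continuous_expR.
    apply: cvgN; rewrite -[X in _ --> X]mulr1; apply: cvgM => //.
    by rewrite -(expr1n R 2); apply: cvg_sqr.
have c2 : cos (2 * pi * q N * (j%:~R + t) + phi) @[N --> \oo] -->
    cos (2 * pi * u * (j%:~R + t) + phi).
  apply: continuous_cvg; first exact: continuous_cos.
  by apply: cvgD; [apply: cvgMr_tmp; apply: cvgMl_tmp; exact: cvg_q|exact: cvg_cst].
apply: cvg_trans (cvgM cL c2).
apply: near_eq_cvg; near=> N.
rewrite /polyaL ifT; last by near: N.
congr (cos _ ^+ _ * cos (_ + _)); have l0 := l_gt0 N; rewrite /q -/(l N); field; lra.
Unshelve. all: by end_near.
Qed.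


Let cvg_polyaR (k : int) : polyaR N (mN N) (pN N) t phi k @[N --> \oo] -->
  expR (- (pi / a * (k%:~R - u) ^+ 2)) * cos (2 * pi * k%:~R * t + phi).
Proof.
have p0 := pi_gt0 R.
pose d N : int := Posz N.*2.+1 * k - pN N.
pose x N : R := k%:~R - q N.
have dE N : (`|d N|%N)%:R = `|x N| * l N :> R.
  rewrite natr_absz intr_norm /d intrB intrM /= -/(l N).
  have l0 := l_gt0 N; rewrite -[in RHS](gtr0_norm l0) -normrM /x /q mulrBl divfK ?gt_eqF//.
  by rewrite [in RHS]mulrC.
have cx : x N @[N --> \oo] --> k%:~R - u by apply: cvgB; [exact: cvg_cst|exact: cvg_q].
have ce : `|x N| * (l N)^-1 @[N --> \oo] --> (0 : R).
  by rewrite -[X in _ --> X](mulr0 `|k%:~R - u|); apply: cvgM => //; exact: cvg_norm.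
have num : x N ^+ 2 / (a / pi) @[N --> \oo] --> (k%:~R - u) ^+ 2 / (a / pi).
  by apply: cvgMr_tmp; exact: cvg_sqr.
have E0 : pi / a * (k%:~R - u) ^+ 2 = (k%:~R - u) ^+ 2 / (a / pi).
  by have ha := a0; field; lra.
apply: cvgM; last exact: cvg_cst.
rewrite E0.
(* The binomial offset is d = l x with x tending to k - u, while m = r l^2. Taking [D] = |d| in the
   two binomial bounds gives the denominators m - |d| and m + |d|, that is l^2 (r - |x| / l) and l^2
   (r + |x| / l). *)
apply: (@squeeze_cvgr _ _ _ _
   (fun N => expR (- (x N ^+ 2 / (r N - `|x N| * (l N)^-1))))
   (fun N => expR (- (x N ^+ 2 / (r N + `|x N| * (l N)^-1))))).
- have h1 : \forall N \near \oo, 0 < r N - `|x N| * (l N)^-1.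
    have c1 : r N - `|x N| * (l N)^-1 @[N --> \oo] --> a / pi - 0 by apply: cvgB.
    by apply: (cvgr_gt _ c1); rewrite subr0.
  have h2 : \forall N \near \oo, 0 < r N by apply: (cvgr_gt _ cvg_r).
  near=> N.
  have r0 : 0 < r N by near: N.
  have rx0 : 0 < r N - `|x N| * (l N)^-1 by near: N.
  have l0 := l_gt0 N.
  have -> : binr R (mN N) (Posz N.*2.+1 * k - pN N) = binr R (mN N) (Posz `|d N|%N) by [].
  have m0 : (0 < mN N)%N by rewrite -(ltr0n R) mE mulr_gt0// exprn_gt0.
  have dm : (`|d N| < mN N)%N.
    rewrite -(ltr_nat R) mE dE.
    have -> : r N * l N ^+ 2 = (r N - `|x N| * (l N)^-1) * l N ^+ 2 + `|x N| * l N.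
      by field; lra.
    by rewrite ltrDr mulr_gt0// exprn_gt0.
  have sq : `|d N|%N%:R ^+ 2 = x N ^+ 2 * l N ^+ 2 :> R.
    by rewrite dE exprMn real_normK ?num_real.
  have b1 := binr_ge R dm (leqnn _); have b2 := binr_le R m0 (leqnn `|d N|%N).
  rewrite sq mE dE in b1 b2.
  have xl : 0 <= `|x N| * (l N)^-1 by rewrite mulr_ge0// invr_ge0 ltW.
  have e1 : x N ^+ 2 * l N ^+ 2 / (r N * l N ^+ 2 - `|x N| * l N) =
      x N ^+ 2 / (r N - `|x N| * (l N)^-1).
    have -> : r N * l N ^+ 2 - `|x N| * l N = (r N - `|x N| * (l N)^-1) * l N ^+ 2.
      by field; lra.
    by rewrite -mulf_div divff ?mulr1// expf_neq0// gt_eqF.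
  have e2 : x N ^+ 2 * l N ^+ 2 / (r N * l N ^+ 2 + `|x N| * l N) =
      x N ^+ 2 / (r N + `|x N| * (l N)^-1).
    have -> : r N * l N ^+ 2 + `|x N| * l N = (r N + `|x N| * (l N)^-1) * l N ^+ 2.
      by field; lra.
    by rewrite -mulf_div divff ?mulr1// expf_neq0// gt_eqF.
  by rewrite e1 in b1; rewrite e2 in b2; rewrite b1 b2.
- apply: continuous_cvg; first exact: continuous_expR.
  apply: cvgN; apply: cvgM; first exact: cvg_sqr.
  rewrite -[X in X^-1]subr0; apply: cvgV; first by rewrite subr0 gt_eqF.
  exact: cvgB.
- apply: continuous_cvg; first exact: continuous_expR.
  apply: cvgN; apply: cvgM; first exact: cvg_sqr.
  rewrite -[X in X^-1]addr0; apply: cvgV; first by rewrite addr0 gt_eqF.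
  exact: cvgD.
Unshelve. all: by end_near.
Qed.

Let expRN1 : 0 <= (expR (-1) : R) < 1.
Proof. by rewrite expR_ge0 expR_lt1 oppr_lt0 ltr01. Qed.

Let dominated_polyaL : \forall N \near \oo, forall j,
  `|polyaL N (mN N) (pN N) t phi j| <=
  expR (1 / (4 * (pi * a / 32)) + 1) * expR (-1) ^+ `|j|%N.
Proof.
have p0 := pi_gt0 R.
apply: filterS r_near => N /andP[r1 _] j; have l0 := l_gt0 N.
rewrite /polyaL; case: ifPn => [jN|_]; last first.
  by rewrite normr0 mulr_ge0 ?exprn_ge0 ?expR_ge0.
rewrite normrM; apply: (@le_trans _ _ (cos (pi * (j%:~R + t) / l N) ^+ (mN N).*2)).
  rewrite -/(l N) [X in X * _]ger0_norm; last by rewrite -mul2n exprM exprn_ge0// sqr_ge0.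
  by rewrite ler_piMr ?cos_max// -mul2n exprM exprn_ge0// sqr_ge0.
have t1 : `|t| <= 1 by have ht := t2; rewrite ler_norml; lra.
(* The rate is (a / 2 pi) (pi^2 / 16): the first factor is the lower bound for r, the second comes
   from [sin_sqr_ge]. *)
apply: le_trans (@expR_quadratic_le _ (pi * a / 32) j t 1 _ t1); last first.
  by rewrite divr_gt0// mulr_gt0.
apply: (@le_trans _ _ (expR (- ((mN N)%:R * ((pi * (j%:~R + t) / l N) ^+ 2 / 16))))).
  by apply: cos_double_le; apply: sin_sqr_ge; exact: argument_le.
rewrite ler_expR lerN2 mE.
have -> : r N * l N ^+ 2 * ((pi * (j%:~R + t) / l N) ^+ 2 / 16) =
   r N * (pi ^+ 2 / 16 * (j%:~R + t) ^+ 2) by field; lra.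
have -> : pi * a / 32 * (j%:~R + t) ^+ 2 =
   a / (2 * pi) * (pi ^+ 2 / 16 * (j%:~R + t) ^+ 2) by field; lra.
by rewrite ler_wpM2r// mulr_ge0 ?sqr_ge0// divr_ge0// sqr_ge0.
Qed.

Let dominated_polyaR : \forall N \near \oo, forall k,
  `|polyaR N (mN N) (pN N) t phi k| <=
  expR (1 / (4 * (pi / (4 * a))) + (`|u| + 1)) * expR (-1) ^+ `|k|%N.
Proof.
have p0 := pi_gt0 R.
have q_near : \forall N \near \oo, `|- q N| <= `|u| + 1.
  move/cvgrPdist_le: cvg_q => /(_ 1 ltr01); apply: filterS => N h.
  rewrite normrN; have := ler_normB u (u - q N); rewrite opprB addrCA subrr addr0.
  by move=> h'; apply: le_trans h' _; rewrite lerD2l.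
near=> N => k; have l0 := l_gt0 N.
have /andP[r1 r2] : a / (2 * pi) <= r N <= 2 * a / pi by near: N.
have qN : `|- q N| <= `|u| + 1 by near: N.
rewrite /polyaR normrM (ger0_norm (binr_ge0 _ _ _)).
apply: (@le_trans _ _ (binr R (mN N) (Posz N.*2.+1 * k - pN N))).
  by rewrite ler_piMr ?cos_max// binr_ge0.
(* Within the binomial row, [binr_le] with [D] = m gives exp(- d^2 / 2m) = exp(- x^2 / 2r), and r <=
   2a / pi turns 1 / 2r into this rate. *)
apply: le_trans (@expR_quadratic_le _ (pi / (4 * a)) k (- q N) _ _ qN); last first.
  by rewrite divr_gt0// mulr_gt0.
have [md|dm] := ltnP (mN N) (absz (Posz N.*2.+1 * k - pN N)%R).
  by rewrite binr_out// expR_ge0.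
have r0 : 0 < r N by apply: lt_le_trans r1; rewrite divr_gt0// mulr_gt0.
have m0 : (0 < mN N)%N by rewrite -(ltr0n R) mE mulr_gt0// exprn_gt0.
apply: le_trans (binr_le R m0 dm) _.
rewrite ler_expR lerN2.
have -> : ((absz (Posz N.*2.+1 * k - pN N)%R))%:R ^+ 2 = (k%:~R - q N) ^+ 2 * l N ^+ 2 :> R.
  rewrite natr_absz intr_norm real_normK ?num_real// intrB intrM /= -/(l N) -exprMn.
  by congr (_ ^+ 2); rewrite /q mulrBl divfK ?gt_eqF// mulrC.
rewrite mE.
have -> : (k%:~R - q N) ^+ 2 * l N ^+ 2 / (r N * l N ^+ 2 + r N * l N ^+ 2) =
  (2 * r N)^-1 * (k%:~R - q N) ^+ 2.
  have -> : r N * l N ^+ 2 + r N * l N ^+ 2 = 2 * r N * l N ^+ 2 by ring.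
  by rewrite -mulf_div divff ?mulr1 1?mulrC// expf_neq0// gt_eqF.
rewrite ler_wpM2r ?sqr_ge0//.
have -> : pi / (4 * a) = (2 * (2 * a / pi))^-1 by have ha := a0; field; lra.
have ha : 0 < 2 * a / pi by rewrite divr_gt0// mulr_gt0.
by rewrite lef_pV2 ?posrE ?(mulr_gt0 _ ha) ?(mulr_gt0 _ r0)// ler_pM2l.
Unshelve. all: by end_near.
Qed.

Let cvg_mN : mN N @[N --> \oo] --> \oo.
Proof.
apply/cvgnyPge => A; near=> N.
have r1 : a / (2 * pi) <= r N by near: N; apply: filterS r_near => N /andP[].
have p0 := pi_gt0 R; have c0 : 0 < a / (2 * pi) by rewrite divr_gt0// mulr_gt0.
have NA : A%:R / (a / (2 * pi)) <= N%:R :> R.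
  by near: N; exact: nbhs_infty_ger.
rewrite -(ler_nat R) mE.
rewrite ler_pdivrMr// in NA; apply: le_trans NA _.
rewrite mulrC ler_pM// ?ltW//.
have -> : l N = 2 * N%:R + 1 by rewrite /l -[LHS]natr1 -mul2n natrM.
have : 0 <= N%:R :> R by [].
nra.
Unshelve. all: by end_near.
Qed.

Lemma poisson_gauss_near (c : R) :
  Num.sqrt n%:R * centralr n @[n --> \oo] --> c ->
  tsum (fun j : int => expR (- (pi * a * (j%:~R + t) ^+ 2)) *
                       cos (2 * pi * u * (j%:~R + t) + phi)) =
  Num.sqrt (pi / a) * c * tsum (fun k : int =>
     expR (- (pi / a * (k%:~R - u) ^+ 2)) * cos (2 * pi * k%:~R * t + phi)).
Proof.
move=> cc; have p0 := pi_gt0 R.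
have geo (C : R) : summ (fun j : int => C * expR (-1) ^+ `|j|%N).
  exact/summZ/summ_geometric_int.
have L := tannery (geo _) dominated_polyaL cvg_polyaL.
have RR := tannery (geo _) dominated_polyaR cvg_polyaR.
(* Since l = sqrt m / sqrt r, the prefactor is sqrt m [centralr] m divided by sqrt r. *)
have S : l N * centralr (mN N) @[N --> \oo] --> Num.sqrt (pi / a) * c.
  apply: cvg_trans (_ : (Num.sqrt (r N)^-1 * (Num.sqrt (mN N)%:R * centralr (mN N))) @[N --> \oo] --> _).
    apply: near_eq_cvg; near=> N.
    have l0 := l_gt0 N.
    have r0 : 0 < r N by near: N; apply: (cvgr_gt _ cvg_r).
    rewrite mulrA mE sqrtrM ?(ltW r0)// sqrtr_sqr gtr0_norm// mulrA -sqrtrM ?invr_ge0 ?(ltW r0)//.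
    by rewrite mulVf ?gt_eqF// sqrtr1 mul1r.
  apply: cvgM; last exact: (cvg_comp _ _ cvg_mN cc).
  apply: continuous_cvg; first exact: sqrt_continuous.
  by rewrite -[pi / a]invf_div; apply: cvgV; [rewrite gt_eqF|].
apply: (cvg_unique _ L); first exact: norm_hausdorff.
rewrite /=; have -> : (fun N => tsum (polyaL N (mN N) (pN N) t phi)) =
  (fun N => l N * centralr (mN N) * tsum (polyaR N (mN N) (pN N) t phi)).
  by apply: funext => N; rewrite polya.
exact: cvgM.
Unshelve. all: by end_near.
Qed.

End Approximation.

(** The sum is 1-periodic in t, so t may be taken in [0, 1). Uniformity in t matters in higher
    dimension, where the shift of one coordinate depends on the others. *)
Lemma gauss_int_bound (c : R) : 0 < c -> exists C : R, forall t,
  (\esum_(z in [set: int]) (expR (- (c * (z%:~R + t) ^+ 2)))%:E <= C%:E)%E.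
Proof.
move=> c0.
pose g (j : int) : R := expR (1 / (4 * c) + 1) * expR (-1) ^+ `|j|%N.
have g0 j : 0 <= g j by rewrite mulr_ge0 ?exprn_ge0 ?expR_ge0.
have sg : summ g.
  by apply/summZ/summ_geometric_int; rewrite expR_ge0 expR_lt1 oppr_lt0 ltr01.
exists (nsum g) => t; rewrite nsumE//.
pose n := Num.floor t; have /andP[h1 h2] := floor_itv t.
rewrite -/n intrD in h1 h2.
rewrite (reindex_esum [set: int] [set: int] (fun z => z - n)); last first.
  by rewrite setTT_bijective; exists (fun z => z + n) => z; rewrite ?subrK ?addrK.
apply: le_esum => z _; rewrite lee_fin.
have -> : (z - n)%:~R + t = z%:~R + (t - n%:~R) :> R by rewrite intrB; ring.
apply: expR_quadratic_le => //; rewrite ger0_norm ?subr_ge0//; lra.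
Qed.

Lemma summ_gauss_int (c t : R) : 0 < c ->
  summ (fun z : int => expR (- (c * (z%:~R + t) ^+ 2))).
Proof.
move=> c0; have [C hC] := gauss_int_bound c0; apply: summ_esum => [z|].
  exact: expR_ge0.
exact: le_lt_trans (hC t) (ltry _).
Qed.

(* The limit c of [central_cvg] equals 1 / sqrt pi, because the case a = 1, t = u = 0
   is self-dual. *)
Theorem poisson_gauss (a t u phi : R) : 0 < a ->
  tsum (fun z : int => expR (- (pi * a * (z%:~R + t) ^+ 2)) *
                       cos (2 * pi * u * (z%:~R + t) + phi)) =
  (Num.sqrt a)^-1 * tsum (fun k : int =>
     expR (- (pi / a * (k%:~R - u) ^+ 2)) * cos (2 * pi * k%:~R * t + phi)).
Proof.
have p0 := pi_gt0 R; have [c c0 cc] := central_cvg.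
have cE : Num.sqrt pi * c = 1.
  have t0 : -1 <= 2 * (0 : R) <= 1 by lra.
  have := @poisson_gauss_near 1 0 0 0 ltr01 t0 c cc.
  rewrite divr1 mulr1; set A := tsum _; set B := tsum _.
  have -> : A = B.
    apply: eq_tsum => z; rewrite subr0 addr0 !mulr0 !mul0r addr0 cos0; ring.
  have B0 : 0 < B.
    have s1 : summ (fun k : int => expR (- (pi * (k%:~R + 0) ^+ 2)) : R).
      exact: summ_gauss_int.
    have -> : B = tsum (fun k : int => expR (- (pi * (k%:~R + 0) ^+ 2))).
      by apply: eq_tsum => k; rewrite mulr0 addr0 cos0 mulr1 addr0 subr0.
    apply: (@lt_le_trans _ _ (tsum (fun k : int => if k == 0 then 1 : R else 0))).
      rewrite (@tsum_fset _ _ [fset (0 : int)]%fset) ?big_seq_fset1 ?eqxx ?ltr01//.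
      by move=> x; rewrite inE => /negbTE ->.
    apply: le_tsum => // [k|].
      by case: eqP => [->|_]; rewrite ?expR_ge0// addr0 expr0n mulr0 oppr0 expR0.
    apply: (@summ_fset _ _ [fset (0 : int)]%fset).
    by move=> x; rewrite inE => /negbTE ->.
  move=> E; apply: (mulIf (lt0r_neq0 B0)); rewrite mul1r.
  by rewrite [RHS]E.
move=> a0.
have near0 s : -1 <= 2 * s <= 1 -> 
  tsum (fun z : int => expR (- (pi * a * (z%:~R + s) ^+ 2)) *
                       cos (2 * pi * u * (z%:~R + s) + phi)) =
  (Num.sqrt a)^-1 * tsum (fun k : int =>
     expR (- (pi / a * (k%:~R - u) ^+ 2)) * cos (2 * pi * k%:~R * s + phi)).
  move=> s2; rewrite (poisson_gauss_near _ _ a0 s2 cc); congr (_ * _).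
  rewrite sqrtrM ?(ltW p0)// mulrAC cE mul1r sqrtrV//; exact: ltW.
(* Both sides are 1-periodic in t; subtracting the nearest integer brings t into the range of
   [near0]. *)
pose n := Num.floor (t + 1 / 2); have /andP[h1 h2] := floor_itv (t + 1 / 2).
rewrite -/n intrD in h1 h2.
have bn : bijective (fun z : int => z - n).
  by exists (fun z => z + n) => z; rewrite ?subrK ?addrK.
rewrite (tsum_reindex _ bn).
transitivity (tsum (fun z : int => expR (- (pi * a * (z%:~R + (t - n%:~R)) ^+ 2)) *
                       cos (2 * pi * u * (z%:~R + (t - n%:~R)) + phi))).
  by apply: eq_tsum => z /=; rewrite intrB -addrA [- _ + t]addrC.
rewrite near0; last by lra.
congr (_ * _); apply: eq_tsum => k; congr (_ * _).
rewrite -[RHS](cos_periodic_int _ (- (k * n))); congr cos.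
by rewrite intrN intrM; ring.
Qed.

End Poisson1.

(** * Poisson summation for positive definite quadratic forms *)

Section Quadratic.
Variable R : realType.

(** The same inner product as [dotv] (see [dotvE]), as a matrix product so that block and transpose
    rules apply. *)
Definition dotp n (u v : 'rV[R]_n) : R := (u *m v^T) 0 0.
Definition qform n (S : 'M[R]_n) (x : 'rV[R]_n) : R := (x *m S *m x^T) 0 0.
Definition intv n (z : 'rV[int]_n) : 'rV[R]_n := map_mx intr z.

Lemma dpDl n (u v w : 'rV[R]_n) : dotp (u + v) w = dotp u w + dotp v w.
Proof. by rewrite /dotp mulmxDl mxE. Qed.

Lemma dpDr n (u v w : 'rV[R]_n) : dotp w (u + v) = dotp w u + dotp w v.
Proof. by rewrite /dotp linearD mulmxDr mxE. Qed.

Lemma dpZl n k (u v : 'rV[R]_n) : dotp (k *: u) v = k * dotp u v.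
Proof. by rewrite /dotp -scalemxAl mxE. Qed.

Lemma dpZr n k (u v : 'rV[R]_n) : dotp u (k *: v) = k * dotp u v.
Proof. by rewrite /dotp linearZ -scalemxAr mxE. Qed.

Lemma dpC n (u v : 'rV[R]_n) : dotp u v = dotp v u.
Proof. by rewrite /dotp !mxE; apply: eq_bigr => i _; rewrite !mxE mulrC. Qed.

Lemma dp_mull n (M : 'M[R]_n) (u v : 'rV[R]_n) : dotp (u *m M) v = dotp u (v *m M^T).
Proof. by rewrite /dotp trmx_mul trmxK mulmxA. Qed.

Lemma dp_scalar n (u v : 'rV[R]_n) : u *m v^T = (dotp u v)%:M.
Proof. by rewrite [LHS]mx11_scalar. Qed.

Lemma qf_dp n (S : 'M[R]_n) x : qform S x = dotp (x *m S) x. Proof. by []. Qed.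

Definition consv n (k : R) (x : 'rV[R]_n) : 'rV[R]_(1 + n) := row_mx k%:M x.

Lemma consvD n k l (x y : 'rV[R]_n) : consv k x + consv l y = consv (k + l) (x + y).
Proof. by rewrite /consv add_row_mx -scalemx1 -[l%:M]scalemx1 -scalerDl scalemx1. Qed.

Lemma consvN n k (x : 'rV[R]_n) : - consv k x = consv (- k) (- x).
Proof. by rewrite /consv opp_row_mx -raddfN. Qed.

Lemma consvP n (x : 'rV[R]_(1 + n)) : exists k y, x = consv k y.
Proof.
exists (lsubmx x 0 0), (rsubmx x).
by rewrite /consv -mx11_scalar hsubmxK.
Qed.

Lemma dp_consv n k l (x y : 'rV[R]_n) : dotp (consv k x) (consv l y) = k * l + dotp x y.
Proof.
by rewrite /dotp /consv tr_row_mx mul_row_col mxE tr_scalar_mx -scalar_mxM !mxE eqxx mulr1n.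
Qed.

(** * Splitting off one coordinate by a Schur complement *)

Section Schur.
Variables (n : nat) (S T : 'M[R]_(1 + n)).
Let a : R := ulsubmx S 0 0.
Let v : 'rV[R]_n := ursubmx S.
Let S1 : 'M[R]_n := drsubmx S - a^-1 *: (v^T *m v).
Let T1 : 'M[R]_n := drsubmx T.
Hypotheses (Ssym : S^T = S) (Tsym : T^T = T) (ST : S *m T = 1%:M).
Hypothesis Spos : forall x, x != 0 -> 0 < qform S x.

Let SE : S = block_mx a%:M v v^T (drsubmx S).
Proof.
rewrite -[LHS]submxK -mx11_scalar; congr block_mx.
by rewrite -[in LHS]Ssym /v trmx_ursub.
Qed.

Let TE : T = block_mx (ulsubmx T 0 0)%:M (ursubmx T) (ursubmx T)^T T1.
Proof.
rewrite -[LHS]submxK -mx11_scalar; congr block_mx.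
by rewrite -[in LHS]Tsym trmx_ursub.
Qed.

Lemma qf_block (b : R) (w : 'rV[R]_n) (M : 'M[R]_n) k x :
  qform (block_mx b%:M w w^T M) (consv k x) = b * k ^+ 2 + 2 * k * dotp w x + qform M x.
Proof.
rewrite qf_dp {1}/consv mul_row_block dp_scalar -scalar_mxM -raddfD mul_scalar_mx.
by rewrite -/(consv _ _) dp_consv dpDl dpZl (dpC x w) qf_dp; ring.
Qed.

Lemma schur_gt0 : 0 < a.
Proof.
have x0 : consv 1 (0 : 'rV[R]_n) != 0.
  apply/eqP => /(congr1 (fun x => dotp x x)); rewrite dp_consv /dotp !mul0mx !mxE.
  by apply/eqP; rewrite addr0 mulr1 oner_eq0.
have := Spos x0; rewrite SE qf_block /dotp /qform linear0 !mulmx0 !mxE; lra.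
Qed.

Lemma qf_schur k x : qform S (consv k x) = a * (k + dotp v x / a) ^+ 2 + qform S1 x.
Proof.
have a0 := schur_gt0.
rewrite SE qf_block /S1 !qf_dp mulmxBr -scalemxAr mulmxA dp_scalar mul_scalar_mx.
rewrite -scaleNr dpDl !dpZl (dpC x v).
by field; rewrite gt_eqF.
Qed.

Lemma schur_sym : S1^T = S1.
Proof.
rewrite /S1 linearB linearZ /= trmx_mul trmxK; congr (_ - _).
by rewrite trmx_drsub Ssym.
Qed.

Lemma schur_pos x : x != 0 -> 0 < qform S1 x.
Proof.
move=> x0; have a0 := schur_gt0.
have y0 : consv (- (dotp v x / a)) x != 0.
  apply: contra_neq x0 => /(congr1 rsubmx); by rewrite row_mxKr linear0.
have := Spos y0; rewrite qf_schur addNr expr0n mulr0 add0r//.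
Qed.

Let ST_block : a *: ursubmx T + v *m T1 = 0 /\ a * ulsubmx T 0 0 + dotp v (ursubmx T) = 1 /\
  v^T *m ursubmx T + drsubmx S *m T1 = 1%:M.
Proof.
move: ST; rewrite {1}SE {1}TE mulmx_block (@scalar_mx_block _ 1 n 1) => /eq_block_mx[h1 h2 _ h4].
split; first by rewrite -mul_scalar_mx.
split => //.
have := congr1 (fun M : 'M[R]_1 => M 0 0) h1.
by rewrite -scalar_mxM dp_scalar -raddfD !mxE eqxx !mulr1n.
Qed.

Lemma schur_dual_sym : T1^T = T1.
Proof. by rewrite /T1 trmx_drsub Tsym. Qed.

(** The inverse of the Schur complement is a corner block of the inverse, so [S1] and [T1] satisfy
    the hypotheses on [S] and [T] in one dimension less. *)
Lemma schur_inv : S1 *m T1 = 1%:M.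
Proof.
have a0 := schur_gt0; have [h1 [_ h4]] := ST_block.
rewrite /S1 mulmxBl -scalemxAl -mulmxA.
have -> : v *m T1 = - (a *: ursubmx T) by apply/eqP; rewrite -addr_eq0 addrC h1.
by rewrite mulmxN -scalemxAr scalerN scalerA mulVf ?gt_eqF// scale1r opprK addrC.
Qed.

(** Dual to [qf_schur], with the dependence reversed: there the shift of the first coordinate
    depends on the remaining ones, here the shift of the remaining ones depends on the first. *)
Lemma qf_dual_schur k x :
  qform T (consv k x) = k ^+ 2 / a + qform T1 (x - (k / a) *: v).
Proof.
have a0 := schur_gt0; have [h1 [h2 _]] := ST_block.
have vT : v *m T1 = - (a *: ursubmx T) by apply/eqP; rewrite -addr_eq0 addrC h1.
set t := ursubmx T in h1 h2 vT *; set t0 := ulsubmx T 0 0 in h2 *.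
rewrite TE qf_block -/t -/t0.
have qE : qform T1 (x - (k / a) *: v) = qform T1 x + 2 * k * dotp t x - k ^+ 2 / a * dotp v t.
  have tx : dotp (x *m T1) v = - a * dotp t x.
    by rewrite dp_mull schur_dual_sym vT -scaleNr dpZr dpC.
  rewrite -[- (_ *: v)]scaleNr !qf_dp mulmxDl -scalemxAl vT -[- (_ *: t)]scaleNr.
  by rewrite !(dpDl, dpDr) !(dpZl, dpZr) tx (dpC t v); field; rewrite gt_eqF.
rewrite qE; have -> : t0 = (1 - dotp v t) / a by rewrite -h2 addrK mulrC mulKf ?gt_eqF.
by field; rewrite gt_eqF.
Qed.

End Schur.

Lemma summ_dep_prod (T T' : choiceType) (f : T -> R) (h : T -> T' -> R) (C : R) :
  (forall i, 0 <= f i) -> (forall i j, 0 <= h i j) -> summ f ->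
  (forall i, summ (h i)) -> (forall i, nsum (h i) <= C) ->
  summ (fun p : T * T' => f p.1 * h p.1 p.2) /\
  nsum (fun p : T * T' => f p.1 * h p.1 p.2) <= C * nsum f.
Proof.
move=> f0 h0 sf sh hC.
have fh0 i j : 0 <= f i * h i j by rewrite mulr_ge0.
have inner i : nsum (fun j => f i * h i j) = f i * nsum (h i).
  by rewrite -tsum_nsum// tsumZ// tsum_nsum.
have s : summ (fun p : T * T' => f p.1 * h p.1 p.2).
  apply: (@tonelli_summ _ _ _ _ (fun i => C * f i)) => [[i j]//|i|]; last exact: summZ.
  rewrite -nsumE//=; last exact: summZ.
  by rewrite lee_fin inner mulrC ler_wpM2r.
split=> //.
have [_ s2 ->] := fubini_nsum (fun p : T * T' => fh0 p.1 p.2) s.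
rewrite -[C * _]mulrC; rewrite -(tsum_nsum f0) mulrC -tsumZ// tsum_nsum; last first.
  move=> i; rewrite mulr_ge0//; apply: le_trans (hC i); exact: nsum_ge0.
apply: le_nsum => [i|i|]; [exact: nsum_ge0| |exact: summZ].
by rewrite inner mulrC ler_wpM2r.
Qed.

(** One bound for all parameters: this is what [summ_dep_prod] asks of the inner sums, whose shift
    varies with the outer index. *)
Definition summ_bounded (I : Type) (T : choiceType) (f : I -> T -> R) :=
  exists C, forall i, summ (f i) /\ nsum (f i) <= C.

Lemma gauss_int_summ_bounded (c : R) : 0 < c ->
  summ_bounded (fun (t : R) (z : int) => expR (- (c * (z%:~R + t) ^+ 2))).
Proof.
move=> c0; have [C hC] := gauss_int_bound c0; exists C => t.
have s := summ_gauss_int t c0; split=> //.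
by rewrite -lee_fin nsumE// => z; exact: expR_ge0.
Qed.

(** The order of the pair fixes which sum is the inner one. The primal side uses [zcons] (first
    coordinate inside), the dual side [consz] (remaining coordinates inside), matching the two Schur
    decompositions. *)
Definition consz n (p : int * 'rV[int]_n) : 'rV[int]_(1 + n) := row_mx p.1%:M p.2.
Definition zcons n (p : 'rV[int]_n * int) : 'rV[int]_(1 + n) := row_mx p.2%:M p.1.

Lemma consz_bij n : bijective (@consz n).
Proof.
exists (fun w => (lsubmx w 0 0, rsubmx w)) => [[k z]|w]; rewrite /consz /=.
  by rewrite row_mxKl row_mxKr mxE eqxx mulr1n.
by rewrite -mx11_scalar hsubmxK.
Qed.

Lemma zcons_bij n : bijective (@zcons n).
Proof.
exists (fun w => (rsubmx w, lsubmx w 0 0)) => [[z k]|w]; rewrite /zcons /=.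
  by rewrite row_mxKl row_mxKr mxE eqxx mulr1n.
by rewrite -mx11_scalar hsubmxK.
Qed.

Lemma intv_consz n k (z : 'rV[int]_n) : intv (consz (k, z)) = consv k%:~R (intv z).
Proof. by rewrite /intv /consz /consv map_row_mx map_scalar_mx. Qed.

Lemma intv_zcons n k (z : 'rV[int]_n) : intv (zcons (z, k)) = consv k%:~R (intv z).
Proof. exact: intv_consz. Qed.

(* The frequency u, the phase phi and the scale l are only needed for the
   induction, which splits off one coordinate by a Schur complement. *)
Theorem poisson_quadratic n (S T : 'M[R]_n) : S^T = S -> T^T = T -> S *m T = 1%:M ->
  (forall x, x != 0 -> 0 < qform S x) ->
  exists2 c, 0 < c & forall l, 0 < l ->
  [/\ summ_bounded (fun t z => expR (- (pi * l * qform S (intv z + t)))),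
      summ_bounded (fun u w => expR (- (pi / l * qform T (intv w - u)))) &
      forall t u phi,
        tsum (fun z => expR (- (pi * l * qform S (intv z + t))) *
                       cos (2 * pi * dotp u (intv z + t) + phi)) =
        c / Num.sqrt l ^+ n * tsum (fun w =>
          expR (- (pi / l * qform T (intv w - u))) * cos (2 * pi * dotp (intv w) t + phi))].
Proof.
have p0 := pi_gt0 R.
elim: n S T => [|n IH] S T Ssym Tsym ST Spos.
  exists 1 => // l l0.
  have qf0 (M : 'M[R]_0) x : qform M x = 0 by rewrite /qform mxE big_ord0.
  have dp0 (x y : 'rV[R]_0) : dotp x y = 0 by rewrite /dotp mxE big_ord0.
  have s (T' : Type) (f : T' -> 'rV[int]_0 -> R) : (forall i z, f i z = 1) -> summ_bounded f.
    move=> f1; exists 1 => i.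
    have sf : summ (f i).
      by apply: (@summ_fset _ _ [fset 0]%fset) => x; rewrite inE (thinmx0 x) eqxx.
    split=> //; rewrite -tsum_nsum => [|z]; last by rewrite f1.
    rewrite (@tsum_fset _ _ [fset 0]%fset) ?big_seq_fset1 ?f1// => x.
    by rewrite inE (thinmx0 x) eqxx.
  split; [by apply: s => *; rewrite qf0 mulr0 oppr0 expR0 ..|].
  move=> t u phi; rewrite expr0 divr1 mul1r; apply: eq_tsum => z.
  by rewrite !qf0 !dp0 !mulr0.
pose a : R := @ulsubmx _ 1 n 1 n S 0 0; pose v : 'rV[R]_n := @ursubmx _ 1 n 1 n S.
pose S1 : 'M[R]_n := @drsubmx _ 1 n 1 n S - a^-1 *: (v^T *m v).
pose T1 : 'M[R]_n := @drsubmx _ 1 n 1 n T.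
have a0 : 0 < a := @schur_gt0 n S Ssym Spos.
have qS k x : qform S (consv k x) = a * (k + dotp v x / a) ^+ 2 + qform S1 x.
  exact: (@qf_schur n S Ssym Spos).
have qT k x : qform T (consv k x) = k ^+ 2 / a + qform T1 (x - (k / a) *: v).
  exact: (@qf_dual_schur n S T Ssym Tsym ST Spos).
have [c c0 H] := IH S1 T1 (@schur_sym n S Ssym) (@schur_dual_sym n T Tsym)
  (@schur_inv n S T Ssym Tsym ST Spos) (@schur_pos n S Ssym Spos).
exists (c / Num.sqrt a); first by rewrite divr_gt0// sqrtr_gt0.
move=> l l0; have [[CS hS] [CT hT] E] := H l l0 => {H IH}.
have la0 : 0 < l * a by rewrite mulr_gt0.
have [CA hA] := @gauss_int_summ_bounded (pi * (l * a)) (mulr_gt0 p0 la0).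
have [CB hB] := @gauss_int_summ_bounded (pi / (l * a)) (divr_gt0 p0 la0).
pose ES t' z := expR (- (pi * l * qform S1 (intv z + t'))) : R.
pose EA tau (k : int) := expR (- (pi * (l * a) * (k%:~R + tau) ^+ 2)) : R.
pose ET u' w := expR (- (pi / l * qform T1 (intv w - u'))) : R.
pose EB u1 (k : int) := expR (- (pi / (l * a) * (k%:~R - u1) ^+ 2)) : R.
have splitS t1 t' z k : expR (- (pi * l * qform S (intv (zcons (z, k)) + consv t1 t'))) =
    ES t' z * EA (t1 + dotp v (intv z + t') / a) k.
  rewrite intv_zcons consvD qS -expRD; congr expR.
  by rewrite addrA; ring.
have splitT u1 u' k w : expR (- (pi / l * qform T (intv (consz (k, w)) - consv u1 u'))) =
    EB u1 k * ET (u' + ((k%:~R - u1) / a) *: v) w.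
  rewrite intv_consz consvN consvD qT -expRD opprD addrA; congr expR.
  by field; lra.
have pS t1 t' : summ (fun p : 'rV[int]_n * int => ES t' p.1 * EA (t1 + dotp v (intv p.1 + t') / a) p.2) /\
   nsum (fun p : 'rV[int]_n * int => ES t' p.1 * EA (t1 + dotp v (intv p.1 + t') / a) p.2) <= CA * CS.
  have [s1 s2] := @summ_dep_prod _ _ (ES t') (fun z => EA (t1 + dotp v (intv z + t') / a)) CA
    (fun=> expR_ge0 _) (fun _ _ => expR_ge0 _) (hS t').1 (fun z => (hA _).1) (fun z => (hA _).2).
  split=> //; apply: le_trans s2 _; apply: ler_wpM2l (hS t').2.
  by apply: le_trans (hA 0).2; apply: nsum_ge0 => k; exact: expR_ge0.
have pT u1 u' : summ (fun p : int * 'rV[int]_n => EB u1 p.1 * ET (u' + ((p.1%:~R - u1) / a) *: v) p.2) /\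
   nsum (fun p : int * 'rV[int]_n => EB u1 p.1 * ET (u' + ((p.1%:~R - u1) / a) *: v) p.2) <= CT * CB.
  have [s1 s2] := @summ_dep_prod _ _ (EB u1) (fun k => ET (u' + ((k%:~R - u1) / a) *: v)) CT
    (fun=> expR_ge0 _) (fun _ _ => expR_ge0 _) (hB (- u1)).1 (fun z => (hT _).1) (fun z => (hT _).2).
  split=> //; apply: le_trans s2 _; apply: ler_wpM2l (hB (- u1)).2.
  by apply: le_trans (hT 0).2; apply: nsum_ge0 => k; exact: expR_ge0.
split.
- exists (CA * CS) => t; have [t1 [t' ->]] := consvP t.
  have [s1 s2] := pS t1 t'; split.
    apply/(summ_reindex _ (@zcons_bij n)); move: s1; congr summ.
    by apply: funext => -[z k]; rewrite /= splitS.
  rewrite -tsum_nsum; last by move=> *; exact: expR_ge0.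
  rewrite (tsum_reindex _ (@zcons_bij n)) tsum_nsum; last by move=> *; exact: expR_ge0.
  move: s2; congr (nsum _ <= _).
  by apply: funext => -[z k]; rewrite /= splitS.
- exists (CT * CB) => u; have [u1 [u' ->]] := consvP u.
  have [s1 s2] := pT u1 u'; split.
    apply/(summ_reindex _ (@consz_bij n)); move: s1; congr summ.
    by apply: funext => -[z k]; rewrite /= splitT.
  rewrite -tsum_nsum; last by move=> *; exact: expR_ge0.
  rewrite (tsum_reindex _ (@consz_bij n)) tsum_nsum; last by move=> *; exact: expR_ge0.
  move: s2; congr (nsum _ <= _).
  by apply: funext => -[z k]; rewrite /= splitT.
move=> t u phi; have [t1 [t' ->]] := consvP t; have [u1 [u' ->]] := consvP u.
have cos_bound (T' : choiceType) (f g : T' -> R) : (forall x, 0 <= f x) -> summ f ->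
    summ (fun x => f x * cos (g x)).
  move=> f0; apply: summ_le => x; rewrite normrM ger0_norm//.
  by rewrite ler_piMr// cos_max.
(* For fixed z the sum over the first coordinate is a one-dimensional Gaussian with shift [tau] z.
   Writing the angle in terms of k + [tau] z leaves a remainder independent of k, put into the phase
   [phi']. *)
pose tau z := t1 + dotp v (intv z + t') / a.
pose phi' z := phi + 2 * pi * (dotp u' (intv z + t') - u1 * (dotp v (intv z + t') / a)).
(* The half-transformed sum: k is already a dual variable and z still a primal one. It is absolutely
   summable, so the sums may be exchanged; for fixed k the sum over z falls under the induction
   hypothesis, k entering through the frequency and the phase. *)
pose G (p : 'rV[int]_n * int) : R := ES t' p.1 * EB u1 p.2 *
  cos (2 * pi * dotp (u' + ((p.2%:~R - u1) / a) *: v) (intv p.1 + t') + (phi + 2 * pi * p.2%:~R * t1)).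
have sG : summ G.
  apply: cos_bound => [p|]; first by rewrite mulr_ge0 ?expR_ge0.
  by apply: summ_prod; [exact: (hS t').1|exact: (hB (- u1)).1].
transitivity ((Num.sqrt (l * a))^-1 * tsum G).
  rewrite (tsum_reindex _ (@zcons_bij n)) fubini_tsum; last first.
    have [s1 _] := pS t1 t'.
    have := cos_bound _ _ (fun p : 'rV[int]_n * int => 2 * pi * dotp (consv u1 u') (intv (zcons p) + consv t1 t') + phi) _ s1.
    move=> /(_ (fun p => mulr_ge0 (expR_ge0 _) (expR_ge0 _))); congr summ.
    by apply: funext => -[z k]; rewrite /= splitS.
  rewrite fubini_tsum// -tsumZ; last exact: summ_tsum.
  apply: eq_tsum => z.
  transitivity (ES t' z * tsum (fun k : int => EA (tau z) k * cos (2 * pi * u1 * (k%:~R + tau z) + phi' z))).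
    rewrite -tsumZ; last by apply: cos_bound => [k|]; [exact: expR_ge0|exact: (hA _).1].
    apply: eq_tsum => k; rewrite /= splitS intv_zcons consvD dp_consv -mulrA; congr (_ * (_ * cos _)).
    by rewrite /tau /phi'; ring.
  rewrite (poisson_gauss _ _ _ la0) mulrCA; congr (_ * _).
  rewrite -tsumZ; last by apply: cos_bound => [k|]; [exact: expR_ge0|exact: (hB (- u1)).1].
  apply: eq_tsum => k; rewrite /G /= mulrA; congr (_ * cos _).
  by rewrite dpDl dpZl /tau /phi'; field; lra.
rewrite fubini_tsumC//.
rewrite (tsum_reindex _ (@consz_bij n)).
set F := _ \o @consz n.
have sF : summ F.
  have [s1 _] := pT u1 u'.
  have := cos_bound _ _ (fun p : int * 'rV[int]_n => 2 * pi * dotp (intv (consz p)) (consv t1 t') + phi) _ s1.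
  move=> /(_ (fun p => mulr_ge0 (expR_ge0 _) (expR_ge0 _))); congr summ.
  by apply: funext => -[z k]; rewrite /F /= splitT.
rewrite [in RHS]fubini_tsum//.
have -> : c / Num.sqrt a / Num.sqrt l ^+ n.+1 = (Num.sqrt (l * a))^-1 * (c / Num.sqrt l ^+ n).
  have sl : 0 < Num.sqrt l by rewrite sqrtr_gt0.
  have sa : 0 < Num.sqrt a by rewrite sqrtr_gt0.
  rewrite sqrtrM ?(ltW l0)// exprS; field; rewrite expf_neq0 ?gt_eqF//.
rewrite -mulrA; congr (_ * _); rewrite -tsumZ; last exact: summ_tsum sF.
apply: eq_tsum => k.
transitivity (EB u1 k * tsum (fun z => ES t' z * cos (2 * pi * dotp (u' + ((k%:~R - u1) / a) *: v) (intv z + t') + (phi + 2 * pi * k%:~R * t1)))).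
  rewrite -tsumZ; last by apply: cos_bound => [z|]; [exact: expR_ge0|exact: (hS t').1].
  by apply: eq_tsum => z; rewrite /G /= mulrCA mulrA.
rewrite E mulrCA; congr (_ * _).
rewrite -tsumZ; last by apply: cos_bound => [z|]; [exact: expR_ge0|exact: (hT _).1].
apply: eq_tsum => w; rewrite /F /= splitT mulrA; congr (_ * cos _).
rewrite intv_consz dp_consv; ring.
Qed.

End Quadratic.

(** * Gaussian mass of a lattice *)

Section LatticeGaussian.
Variable R : realType.

Lemma dp0r n (u : 'rV[R]_n) : dotp u 0 = 0.
Proof. by rewrite /dotp trmx0 mulmx0 mxE. Qed.

Definition nsq n (u : 'rV[R]_n) : R := dotp u u.

Lemma nsq_ge0 n (u : 'rV[R]_n) : 0 <= nsq u.
Proof.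
by rewrite /nsq /dotp mxE sumr_ge0// => i _; rewrite mxE -expr2 sqr_ge0.
Qed.

Lemma nsq_eq0 n (u : 'rV[R]_n) : (nsq u == 0) = (u == 0).
Proof.
apply/eqP/eqP => [|->]; last by rewrite /nsq /dotp mul0mx mxE.
rewrite /nsq /dotp mxE => /eqP; rewrite psumr_eq0 => [/allP h|i _]; last first.
  by rewrite mxE -expr2 sqr_ge0.
apply/rowP => i; have := h i (mem_index_enum i).
by rewrite !mxE mulf_eq0 orbb => /eqP.
Qed.

Lemma qf_gram n (B : 'M[R]_n) x : qform (B *m B^T) x = nsq (x *m B).
Proof. by rewrite /qform /nsq /dotp trmx_mul !mulmxA. Qed.

(** In terms of the scale s, [l] is s^(-2), so the dual side carries [l^-1]. Lattice points are
    indexed by their integer coordinates. *)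
Definition gaussian n (B : 'M[R]_n) (l : R) (x : 'rV[R]_n) (z : 'rV[int]_n) : R :=
  expR (- (pi * l * nsq (intv R z *m B - x))).

Lemma gaussian_ge0 n (B : 'M[R]_n) l x z : 0 <= gaussian B l x z.
Proof. exact: expR_ge0. Qed.

(** The hypothesis says that the rows of [D] form the basis dual to the rows of [B]. The constant c,
    an inverse covolume, is chosen before l so that masses at two scales can be compared. *)
Lemma poisson_lattice n (B D : 'M[R]_n) : B *m D^T = 1%:M ->
  exists2 c, 0 < c & forall l, 0 < l ->
  [/\ forall x, summ (gaussian B l x),
      summ (gaussian D l^-1 0) &
      forall x, tsum (gaussian B l x) =
        c / Num.sqrt l ^+ n * tsum (fun w => gaussian D l^-1 0 w *
          cos (2 * pi * dotp (intv R w) (- (x *m D^T))))].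
Proof.
move=> BD; have DB : D^T *m B = 1%:M by apply: mulmx1C.
have BT : B^T *m D = 1%:M by rewrite -[LHS]trmxK trmx_mul trmxK DB trmx1.
have Ssym : (B *m B^T)^T = B *m B^T by rewrite trmx_mul trmxK.
have Tsym : (D *m D^T)^T = D *m D^T by rewrite trmx_mul trmxK.
have ST : (B *m B^T) *m (D *m D^T) = 1%:M.
  by rewrite -mulmxA [B^T *m _]mulmxA BT mul1mx.
have Spos x : x != 0 -> 0 < qform (B *m B^T) x.
  move=> x0; rewrite qf_gram lt_def nsq_ge0 andbT nsq_eq0.
  apply: contra_neq x0 => xB; by rewrite -[x]mulmx1 -BD mulmxA xB mul0mx.
have [c c0 H] := poisson_quadratic Ssym Tsym ST Spos; exists c => // l l0.
have [[C1 h1] [C2 h2] E] := H l l0 => {H}.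
have gB x : gaussian B l x = fun z => expR (- (pi * l * qform (B *m B^T) (intv R z + - (x *m D^T)))).
  apply: funext => z; rewrite /gaussian qf_gram mulmxDl mulNmx -mulmxA DB mulmx1.
  by [].
have gD : gaussian D l^-1 0 = fun w => expR (- (pi / l * qform (D *m D^T) (intv R w - 0))).
  by apply: funext => w; rewrite /gaussian qf_gram !subr0.
split.
- by move=> x; rewrite gB; exact: (h1 _).1.
- by rewrite gD; exact: (h2 0).1.
- move=> x; rewrite gB gD.
  have := E (- (x *m D^T)) 0 0.
  under [in X in X -> _]eq_tsum => z do rewrite /dotp mul0mx mxE mulr0 addr0 cos0 mulr1.
  by move=> ->; congr (_ * _); apply: eq_tsum => w; rewrite addr0.
Qed.

(** * Banaszczyk's tail bound *)

Section Tail.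
Variables (n : nat) (B D : 'M[R]_n).
Hypothesis BD : B *m D^T = 1%:M.

Let mass l := tsum (gaussian B l 0).

Lemma summ_gaussian l x : 0 < l -> summ (gaussian B l x).
Proof. by move=> l0; have [c _ H] := poisson_lattice BD; have [s _ _] := H l l0; exact: s. Qed.

Lemma summ_gaussian_cos (l : R) (g : 'rV[int]_n -> R) : 0 < l ->
  summ (fun w => gaussian D l^-1 0 w * cos (g w)).
Proof.
move=> l0; have [c _ /(_ l l0)[_ s _]] := poisson_lattice BD.
apply: summ_le s => w; rewrite normrM ger0_norm ?gaussian_ge0//.
by rewrite ler_piMr ?gaussian_ge0// cos_max.
Qed.

(* All the Fourier coefficients are non-negative. *)
Lemma gaussian_shift_le l x : 0 < l -> tsum (gaussian B l x) <= mass l.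
Proof.
move=> l0; have [c c0 /(_ l l0)[_ s E]] := poisson_lattice BD.
rewrite /mass !E ler_wpM2l ?divr_ge0 ?(ltW c0) ?exprn_ge0 ?sqrtr_ge0//.
apply: le_tsum => [w||]; try exact: summ_gaussian_cos.
rewrite mul0mx oppr0 dp0r mulr0 cos0.
by rewrite ler_wpM2l ?gaussian_ge0// cos_le1.
Qed.

(** Widening the Gaussian narrows its dual, so on the dual side every term decreases and only the
    prefactor grows. *)
Lemma gaussian_dilate_le l k : 0 < l -> 1 <= k ->
  mass (l / k) <= Num.sqrt k ^+ n * mass l.
Proof.
move=> l0 k1; have k0 : 0 < k by lra.
have lk : 0 < l / k by rewrite divr_gt0.
have [c c0 H] := poisson_lattice BD.
have [_ s1 E1] := H l l0; have [_ s2 E2] := H _ lk.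
rewrite /mass E1 E2 mulrA.
have c2 : Num.sqrt k ^+ n * (c / Num.sqrt l ^+ n) = c / Num.sqrt (l / k) ^+ n.
  have sk : 0 < Num.sqrt k by rewrite sqrtr_gt0.
  have sl : 0 < Num.sqrt l by rewrite sqrtr_gt0.
  rewrite sqrtrM ?(ltW l0)// sqrtrV ?(ltW k0)// exprMn exprVn.
  by field; rewrite !expf_neq0// gt_eqF.
rewrite c2 ler_wpM2l ?divr_ge0 ?(ltW c0) ?exprn_ge0 ?sqrtr_ge0//.
apply: le_tsum => [w||]; try exact: summ_gaussian_cos.
rewrite mul0mx oppr0 dp0r mulr0 cos0 !mulr1 ler_expR lerN2.
rewrite ler_wpM2r ?nsq_ge0// ler_wpM2l ?pi_ge0// invf_div ler_pdivlMr//.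
by rewrite mulVf// gt_eqF.
Qed.

(** Write the weight as exp(- pi l (1 - 1/k) y) exp(- pi (l/k) y), with y the squared norm. On far
    points the first factor is small, and the second sums to at most the mass of the wider
    Gaussian. *)
Lemma gaussian_tail l k r x (P : pred 'rV[int]_n) : 0 < l -> 1 <= k ->
  (forall z, P z -> r <= nsq (intv R z *m B - x)) ->
  tsum (fun z => if P z then gaussian B l x z else 0) <=
  expR (- (pi * l * (1 - k^-1) * r)) * Num.sqrt k ^+ n * mass l.
Proof.
move=> l0 k1 hr; have k0 : 0 < k by lra.
have lk : 0 < l / k by rewrite divr_gt0.
have ki : k^-1 <= 1 by rewrite invf_le1.
rewrite -mulrA; apply: le_trans (ler_wpM2l (expR_ge0 _) (gaussian_dilate_le l0 k1)).
apply: le_trans (ler_wpM2l (expR_ge0 _) (gaussian_shift_le x lk)).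
rewrite -tsumZ; last exact: summ_gaussian.
apply: le_tsum => [z||].
- case: ifPn => [Pz|_]; last by rewrite mulr_ge0 ?expR_ge0.
  rewrite /gaussian -expRD ler_expR.
  have := hr z Pz; set y := nsq _ => ry.
  have : pi * l * (1 - k^-1) * r <= pi * l * (1 - k^-1) * y.
    by rewrite ler_wpM2l// mulr_ge0 ?subr_ge0// mulr_ge0 ?pi_ge0 ?ltW.
  have -> : pi * (l / k) * y = pi * l * y - pi * l * (1 - k^-1) * y by ring.
  lra.
- apply: (summ_le _ (summ_gaussian x l0)) => z; case: ifP => _.
    by rewrite ger0_norm ?gaussian_ge0.
  by rewrite normr0 gaussian_ge0.
- exact/summZ/summ_gaussian.
Qed.

(* The dilation factor 1 + d turns the bound of [gaussian_tail] into e^(-n d^2 / 2). *)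
Lemma gaussian_tail_exp l d x (P : pred 'rV[int]_n) : 0 < l -> 0 < d ->
  (forall z, P z -> n%:R * (1 + d) ^+ 2 / (2 * pi * l) <= nsq (intv R z *m B - x)) ->
  tsum (fun z => if P z then gaussian B l x z else 0) <=
  expR (- (n%:R * d ^+ 2 / 2)) * mass l.
Proof.
move=> l0 d0 hr; have p0 := pi_gt0 R.
have k1 : 1 <= 1 + d by lra.
apply: le_trans (gaussian_tail l0 k1 hr) _.
have m0 : 0 <= mass l by apply: tsum_ge0 => z; exact: gaussian_ge0.
apply: ler_wpM2r => //.
(* The far points gain n d (1 + d) / 2 in the exponent and the dilation loses at most n d / 2,
   leaving n d^2 / 2. *)
have sq : Num.sqrt (1 + d) <= expR (d / 2).
  rewrite -(ger0_norm (expR_ge0 (d / 2))) -sqrtr_sqr ler_wsqrtr// -expRM_natl.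
  by rewrite mulrC divfK// expR_ge1Dx.
apply: (@le_trans _ _ (expR (- (n%:R * (d * (1 + d)) / 2)) * expR (d / 2) ^+ n)).
  apply: ler_pM; rewrite ?expR_ge0 ?exprn_ge0 ?sqrtr_ge0//.
    rewrite ler_expR lerN2 le_eqVlt; apply/orP; left; apply/eqP.
    by field; lra.
  by rewrite lerXn2r ?nnegrE ?sqrtr_ge0 ?expR_ge0.
rewrite -expRM_natl -expRD ler_expR le_eqVlt; apply/orP; left; apply/eqP.
by field.
Qed.

Definition mass_nz l := tsum (fun z : 'rV[int]_n => if z != 0 then gaussian B l 0 z else 0).

Lemma gaussian_nz_summ l x : 0 < l ->
  summ (fun z : 'rV[int]_n => if z != 0 then gaussian B l x z else 0).
Proof.
move=> l0; apply: (summ_le _ (summ_gaussian x l0)) => z; case: ifP => _.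
  by rewrite ger0_norm ?gaussian_ge0.
by rewrite normr0 gaussian_ge0.
Qed.

Lemma mass_split l : 0 < l -> mass l = 1 + mass_nz l.
Proof.
move=> l0; rewrite /mass /mass_nz.
rewrite -[X in X + _](_ : tsum (fun z : 'rV[int]_n => if z == 0 then gaussian B l 0 z else 0) = 1).
  rewrite -tsumD; last exact: gaussian_nz_summ.
    by apply: eq_tsum => z; case: eqP => _; rewrite ?addr0 ?add0r.
  apply: (@summ_fset _ _ [fset (0 : 'rV[int]_n)]%fset) => z.
  by rewrite inE => /negbTE ->.
rewrite (@tsum_fset _ _ [fset (0 : 'rV[int]_n)]%fset) ?big_seq_fset1 ?eqxx.
  by rewrite /gaussian /intv map_mx0 mul0mx subr0 /nsq /dotp mul0mx mxE mulr0 oppr0 expR0.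
by move=> z; rewrite inE => /negbTE ->.
Qed.

(** All nonzero points are far, so the tail bound reads m <= e (1 + m) with e <= 1/3. *)
Lemma mass_nz_small l d : 0 < l -> 0 < d -> 3 * expR (- (n%:R * d ^+ 2 / 2)) <= 1 ->
  (forall z : 'rV[int]_n, z != 0 -> n%:R * (1 + d) ^+ 2 / (2 * pi * l) <= nsq (intv R z *m B)) ->
  mass_nz l <= 1 / 2.
Proof.
move=> l0 d0 b hr.
have := @gaussian_tail_exp l d 0 (fun z => z != 0) l0 d0.
move=> H.
have {H} : mass_nz l <= expR (- (n%:R * d ^+ 2 / 2)) * mass l.
  by apply: H => z z0; rewrite subr0; exact: hr.
rewrite mass_split//; set e := expR _ in b *; set m := mass_nz l.
have m0 : 0 <= m by apply: tsum_ge0 => z; case: ifP => // _; exact: gaussian_ge0.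
nra.
Qed.

End Tail.

(** If every lattice point were far from x, the tail bound would give, after cancelling the Poisson
    factor, 1 - m <= e (1 + m), where m is the nonzero dual mass and each cosine has been bounded
    below by -1. With m <= 1/2 this means e >= 1/3. *)
Lemma covering_small n (B D : 'M[R]_n) (l d : R) : B *m D^T = 1%:M ->
  0 < l -> 0 < d -> 3 * expR (- (n%:R * d ^+ 2 / 2)) < 1 ->
  mass_nz D l^-1 <= 1 / 2 ->
  forall x, exists z, nsq (intv R z *m B - x) <= n%:R * (1 + d) ^+ 2 / (2 * pi * l).
Proof.
move=> BD l0 d0 b hD x; apply: contrapT => /forallNP far.
have DB : D *m B^T = 1%:M by rewrite -[D]trmxK -trmx_mul BD trmx1.
have li0 : 0 < l^-1 by rewrite invr_gt0.
have h := @gaussian_tail_exp n B D BD l d x predT l0 d0.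
have [c c0 /(_ l l0)[_ s E]] := poisson_lattice BD.
have {}h : tsum (gaussian B l x) <= expR (- (n%:R * d ^+ 2 / 2)) * tsum (gaussian B l 0).
  by apply: h => z _; have /negP := far z; rewrite -ltNge; exact: ltW.
have sD := gaussian_nz_summ DB 0 li0.
have s1 : summ (fun w : 'rV[int]_n => if w == 0 then 1 else 0 : R).
  by apply: (@summ_fset _ _ [fset (0 : 'rV[int]_n)]%fset) => z; rewrite inE => /negbTE ->.
have low : 1 - mass_nz D l^-1 <= tsum (fun w => gaussian D l^-1 0 w * cos (2 * pi * dotp (intv R w) (- (x *m D^T)))).
  rewrite lerBlDr -tsumD//; last exact: summ_gaussian_cos BD _ _ l0.
  rewrite -[leLHS](_ : tsum (fun w : 'rV[int]_n => if w == 0 then 1 else 0 : R) = 1); last first.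
    rewrite (@tsum_fset _ _ [fset (0 : 'rV[int]_n)]%fset) ?big_seq_fset1 ?eqxx//.
    by move=> z; rewrite inE => /negbTE ->.
  apply: le_tsum => // [w|]; last by apply: summD => //; exact: summ_gaussian_cos BD _ _ l0.
  case: eqP => [->|_] /=.
    rewrite /gaussian /intv map_mx0 !mul0mx subr0 /nsq /dotp !mul0mx mxE !mulr0 oppr0.
    by rewrite expR0 cos0 mulr1 addr0.
  rewrite -[X in _ + X]mulr1 -mulrDr mulr_ge0 ?gaussian_ge0//.
have up : tsum (fun w => gaussian D l^-1 0 w * cos (2 * pi * dotp (intv R w) (- (0 *m D^T)))) =
    1 + mass_nz D l^-1.
  rewrite -(mass_split DB li0); apply: eq_tsum => w.
  by rewrite mul0mx oppr0 dp0r mulr0 cos0 mulr1.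
rewrite !E up in h.
have c'0 : 0 < c / Num.sqrt l ^+ n by rewrite divr_gt0// exprn_gt0// sqrtr_gt0.
move: h low; set c' := c / _ in c'0 *; set A := tsum _; set e := expR _ in b *.
rewrite mulrCA ler_pM2l// => h low.
have e0 : 0 <= e by exact: expR_ge0.
have m0 : 0 <= mass_nz D l^-1.
  by apply: tsum_ge0 => z; case: ifP => // _; exact: gaussian_ge0.
move: (mass_nz D l^-1) hD m0 h low => m; nra.
Qed.

End LatticeGaussian.

(** * Lattices, duality and counting *)

Section Lattices.
Variable R : realType.

Lemma dotvE n (u v : 'rV[R]_n) : dotv u v = dotp u v.
Proof. by rewrite /dotp mxE; apply: eq_bigr => i _; rewrite mxE. Qed.

Lemma enormE n (u : 'rV[R]_n) : enorm u = Num.sqrt (nsq u).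
Proof. by rewrite /enorm dotvE. Qed.

Lemma enorm_ge0 n (u : 'rV[R]_n) : 0 <= enorm u.
Proof. exact: sqrtr_ge0. Qed.

Lemma enorm_sqr n (u : 'rV[R]_n) : enorm u ^+ 2 = nsq u.
Proof. by rewrite enormE sqr_sqrtr// nsq_ge0. Qed.

Lemma enorm_gt0 n (u : 'rV[R]_n) : (0 < enorm u) = (u != 0).
Proof. by rewrite lt_def enorm_ge0 andbT -sqrf_eq0 enorm_sqr nsq_eq0. Qed.

Lemma lattice_ofP n (B : 'M[R]_n) y : lattice_of B y <-> exists z, y = intv R z *m B.
Proof.
split => [[z ->]|[z ->]].
  exists (\row_i z i); rewrite mulmx_sum_row; apply: eq_bigr => i _.
  by rewrite !mxE.
exists (fun i => z 0 i); rewrite mulmx_sum_row; apply: eq_bigr => i _.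
by rewrite !mxE.
Qed.

(** The coordinates of w in the basis [D] are its inner products with the rows of [B]. *)
Lemma dual_lattice_of n (B D : 'M[R]_n) : B *m D^T = 1%:M ->
  dual_lattice (lattice_of B) = lattice_of D.
Proof.
move=> BD; have DB : B^T *m D = 1%:M.
  by rewrite -[LHS]trmxK trmx_mul trmxK (mulmx1C BD) trmx1.
apply/seteqP; split => w.
  move=> hw; apply/lattice_ofP.
  have hi i : exists m : int, (w *m B^T) 0 i = m%:~R.
    apply/intrP; have := hw (row i B); rewrite dotvE /dotp tr_row => h.
    have -> : (w *m B^T) 0 i = (w *m col i B^T) 0 0 by rewrite !mxE; apply: eq_bigr => j _; rewrite !mxE.
    apply: h; apply/lattice_ofP; exists (delta_mx 0 i).
    by rewrite /intv map_delta_mx -rowE.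
  have [f hf] := choice hi; exists (\row_i f i).
  rewrite -[LHS]mulmx1 -DB mulmxA; congr (_ *m _).
  by apply/rowP => i; rewrite hf !mxE.
move=> /lattice_ofP[z ->] y /lattice_ofP[z' ->].
rewrite dotvE /dotp trmx_mul mulmxA -[_ *m D *m _]mulmxA.
have -> : D *m B^T = 1%:M by exact: mulmx1C.
rewrite mulmx1 mxE rpred_sum// => i _; rewrite !mxE; apply: rpredM.
  by apply/intrP; eexists.
by apply/intrP; eexists.
Qed.

Lemma is_lattice_dual n (L : set 'rV[R]_n) : is_lattice L ->
  exists B D : 'M[R]_n, [/\ B *m D^T = 1%:M, L = lattice_of B,
    dual_lattice L = lattice_of D & is_lattice (lattice_of D)].
Proof.
move=> [B rB ->]; have uB : B \in unitmx by rewrite -row_free_unit.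
exists B, (invmx B)^T.
have BD : B *m (invmx B)^T^T = 1%:M by rewrite trmxK mulmxV.
split=> //; first exact: dual_lattice_of.
by exists (invmx B)^T => //; rewrite row_free_unit unitmx_tr unitmx_inv.
Qed.

Lemma intv_mul_inj n (B D : 'M[R]_n) : B *m D^T = 1%:M ->
  injective (fun z => intv R z *m D).
Proof.
move=> BD z z' /= /(congr1 (fun M => M *m B^T)).
have DB : D *m B^T = 1%:M by rewrite -[D]trmxK -trmx_mul BD trmx1.
rewrite -!mulmxA DB !mulmx1 => /rowP h; apply/rowP => i; have := h i.
by rewrite !mxE => /intr_inj.
Qed.

Lemma intv_mul_eq0 n (B D : 'M[R]_n) z : B *m D^T = 1%:M ->
  (intv R z *m D == 0) = (z == 0).
Proof.
move=> BD; apply/eqP/eqP => [h|->]; last by rewrite /intv map_mx0 mul0mx.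
by apply: (intv_mul_inj BD) => /=; rewrite h /intv map_mx0 mul0mx.
Qed.

Lemma lambda1_le n (D : 'M[R]_n) y : lattice_of D y -> y != 0 ->
  lambda1 (lattice_of D) <= enorm y.
Proof.
move=> Dy y0; apply: ge_inf; last by exists y => //; split=> //; exact/eqP.
by exists 0 => _ [z _ <-]; exact: enorm_ge0.
Qed.

Lemma lambda1_ge0 n (L : set 'rV[R]_n) : 0 <= lambda1 L.
Proof.
rewrite /lambda1; have [->|/set0P ne] := eqVneq [set enorm y | y in L `\ 0] set0.
  by rewrite inf0.
by apply: lb_le_inf => // _ [z _ <-]; exact: enorm_ge0.
Qed.

Lemma covering_radius_le n (B : 'M[R]_n) (r : R) :
  (forall x, exists z, nsq (intv R z *m B - x) <= r ^+ 2) -> 0 <= r ->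
  covering_radius (lattice_of B) <= r.
Proof.
move=> h r0; apply: ge_sup; first by exists (inf [set enorm (y - 0) | y in lattice_of B]), 0.
move=> _ [x _ <-]; have [z hz] := h x.
apply: (@le_trans _ _ (enorm (intv R z *m B - x))).
  apply: ge_inf; first by exists 0 => _ [y _ <-]; exact: enorm_ge0.
  by exists (intv R z *m B) => //; apply/lattice_ofP; exists z.
by rewrite enormE -(ger0_norm r0) -sqrtr_sqr ler_wsqrtr.
Qed.

(** Here l is the parameter of the dual Gaussian, the inverse of the one in [covering_small]. *)
Lemma covering_radius_mass n (B D : 'M[R]_n) (l d : R) : B *m D^T = 1%:M ->
  0 < l -> 0 < d -> 3 * expR (- (n%:R * d ^+ 2 / 2)) < 1 ->
  mass_nz D l <= 1 / 2 ->
  covering_radius (lattice_of B) <= Num.sqrt (n%:R * (1 + d) ^+ 2 * l / (2 * pi)).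
Proof.
move=> BD l0 d0 b h; have p0 := pi_gt0 R.
apply: covering_radius_le (sqrtr_ge0 _) => x.
have li : 0 < l^-1 by rewrite invr_gt0.
have [|z hz] := covering_small BD li d0 b _ x; first by rewrite invrK.
exists z; apply: le_trans hz _; rewrite sqr_sqrtr; last first.
  apply: divr_ge0; last by apply: mulr_ge0 => //; exact: pi_ge0.
  by apply: mulr_ge0 (ltW l0); apply: mulr_ge0 => //; exact: sqr_ge0.
rewrite le_eqVlt; apply/orP; left; apply/eqP; clear BD; field; lra.
Qed.

(** The choice d = 2 makes the exponential condition hold for every n >= 1, and l puts the far
    radius exactly at the minimum [lam]. The product is then at most n (1 + 2)^2 / (2 pi), rounded
    up to 9 n. *)
Lemma transference_banaszczyk n (B D : 'M[R]_n) : B *m D^T = 1%:M -> (1 <= n)%N ->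
  covering_radius (lattice_of B) * lambda1 (lattice_of D) <= n%:R * 9.
Proof.
move=> BD n1; have p0 := pi_gt0 R; have p2 := pi_ge2 R.
have n1' : 1 <= n%:R :> R by rewrite ler1n.
set lam := lambda1 _; have := lambda1_ge0 (lattice_of D); rewrite -/lam.
rewrite le_eqVlt => /orP[/eqP <-|lam0]; first by rewrite mulr0 mulr_ge0.
have b : 3 * expR (- (n%:R * 2 ^+ 2 / 2)) < 1 :> R.
  rewrite expRN ltr_pdivrMr ?expR_gt0// mul1r.
  have n20 : n%:R * 2 ^+ 2 / 2 != 0 :> R by clear BD; lra.
  by apply: le_lt_trans (expR_gt1Dx n20); clear BD; lra.
pose l := n%:R * (1 + 2) ^+ 2 / (2 * pi * lam ^+ 2).
have l0 : 0 < l by rewrite divr_gt0 ?mulr_gt0 ?exprn_gt0//; clear BD; lra.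
have DB : D *m B^T = 1%:M by rewrite -[D]trmxK -trmx_mul BD trmx1.
have h : mass_nz D l <= 1 / 2.
  apply: (mass_nz_small DB l0 (d := 2)) => //; first exact: ltW.
  move=> z z0; rewrite -enorm_sqr.
  have -> : n%:R * (1 + 2) ^+ 2 / (2 * pi * l) = lam ^+ 2 by rewrite /l; clear BD DB; field; lra.
  rewrite lerXn2r ?nnegrE ?(ltW lam0) ?enorm_ge0//; apply: lambda1_le.
    by apply/lattice_ofP; exists z.
  by rewrite (intv_mul_eq0 _ BD).
have d2 : 0 < 2 :> R by [].
have := covering_radius_mass BD l0 d2 b h.
have -> : n%:R * (1 + 2) ^+ 2 * l / (2 * pi) = (n%:R * 9 / (2 * pi * lam)) ^+ 2.
  by rewrite /l; clear BD DB h; field; lra.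
rewrite sqrtr_sqr ger0_norm; last by rewrite divr_ge0 ?mulr_ge0 ?(ltW lam0) ?pi_ge0.
rewrite -(ler_pM2r lam0) => /le_trans; apply.
have -> : n%:R * 9 / (2 * pi * lam) * lam = n%:R * 9 / (2 * pi) by clear BD DB h; field; lra.
by clear BD DB h; rewrite ler_pdivrMr; [nra|lra].
Qed.

Lemma shell_radius (N p E g lam : R) : 0 < N -> 0 < p -> 0 < lam ->
  p * (N / (2 * p) * E / lam ^+ 2) * (g * lam) ^+ 2 =
  (N + 2) / 2 * (N / (N + 2) * (E * g ^+ 2)).
Proof. by move=> N0 p0 lam0; field; lra. Qed.

(** Bounding the Gaussian exponent (N/2) e^X by its tangent of slope N/2 would cancel J against the
    growth of the count, and the sum over shells would diverge. Using N / (N + 2) >= e^(-2/N), the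
    slope becomes (N + 2)/2, and the excess 1 yields the decay - d J. The 5 collects 1, -2k <= 2 and
    2/N <= 2. *)
Lemma shell_exponent (N k d J : R) : 1 <= N -> 0 < d -> -1 <= k -> 0 <= J ->
  - ((N + 2) / 2 * (N / (N + 2) * expR (-1 + 2 * k + 2 * d + d * J))) +
  (N * k + N * (d * (J + 1) / 2)) <= 5 - N * d / 2 - d * J.
Proof.
move=> N1 d0 k1 J0.
have low : expR (- (2 / N)) <= N / (N + 2).
  rewrite expRN -[leRHS]invf_div lef_pV2 ?posrE ?expR_gt0 ?divr_gt0//; try lra.
  by apply: le_trans (expR_ge1Dx _); rewrite mulrDl divff; lra.
have := ler_wpM2r (expR_ge0 (-1 + 2 * k + 2 * d + d * J)) low.
rewrite -expRD => low2.
have low3 := le_trans (expR_ge1Dx _) low2.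
have N2 : 0 <= (N + 2) / 2 by lra.
have := ler_wpM2l N2 low3.
set X := _ * (N / _ * _).
have -> : (N + 2) / 2 * (1 + (- (2 / N) + (-1 + 2 * k + 2 * d + d * J))) =
  N * k + N * d + N * d * J / 2 + 2 * k + 2 * d + d * J - 1 - 2 / N by field; lra.
have n2 : 2 / N <= 2 by rewrite ler_pdivrMr; lra.
have jd : 0 <= d * J by rewrite mulr_ge0// ltW.
have -> : N * (d * (J + 1) / 2) = N * d * J / 2 + N * d / 2 by field.
move: (N * d) (N * d * J) (N * k) => a b c; lra.
Qed.

(* With lam the minimum, cut the nonzero vectors into the shells
   [e^(dj/2) lam, e^(d(j+1)/2) lam): the j-th one contributes at most
   e^(5 - nd/2 - dj). *)
Lemma mass_nz_count n (B D : 'M[R]_n) (lam k d : R) : B *m D^T = 1%:M -> (1 <= n)%N ->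
  0 < lam -> 0 < d -> -1 <= k ->
  (forall z, z != 0 -> lam <= enorm (intv R z *m D)) ->
  (forall alpha, 1 <= alpha ->
    (counting [set y | lattice_of D y /\ (0 < enorm y <= alpha * lam)%R] <=
     (expR (n%:R * k) * alpha ^+ n)%:E)%E) ->
  mass_nz D (n%:R / (2 * pi) * expR (-1 + 2 * k + 2 * d) / lam ^+ 2) <=
  expR (5 - n%:R * d / 2) / (1 - expR (- d)).
Proof.
move=> BD n1 lam0 d0 k1 hlam hcount; have p0 := pi_gt0 R.
have n1' : 1 <= n%:R :> R by rewrite ler1n.
(* This is e^(2d) times the critical value e^(2k) n / (2 pi e lam^2), at which the largest term of
   count times weight is 1. *)
set l := n%:R / _ * _ / _.
have l0 : 0 < l by rewrite /l divr_gt0 ?mulr_gt0 ?expR_gt0 ?exprn_gt0 ?invr_gt0 ?mulr_gt0//; clear BD; lra.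
have DB : D *m B^T = 1%:M by rewrite -[D]trmxK -trmx_mul BD trmx1.
pose g (j : nat) := expR (d * j%:R / 2) : R.
(* A whole ball stands in for the j-th shell, because the hypothesis counts balls; the overcount
   only enlarges the upper bound. The weight [e] j is taken at the inner radius of the shell. *)
pose P (j : nat) (z : 'rV[int]_n) := (z != 0) && (enorm (intv R z *m D) <= g j.+1 * lam).
pose e (j : nat) := expR (- (pi * l * (g j * lam) ^+ 2)) : R.
pose f (j : nat) := expR (5 - n%:R * d / 2) * expR (- d) ^+ j : R.
have f0 j : 0 < f j by rewrite mulr_gt0 ?exprn_gt0 ?expR_gt0.
have ed : 0 <= expR (- d) < 1 by rewrite expR_ge0 expR_lt1 oppr_lt0.
have [sgeo ngeo] := geometric_nsum ed.
have sf : summ f by exact: summZ.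
have nf : nsum f <= expR (5 - n%:R * d / 2) / (1 - expR (- d)).
  rewrite -tsum_nsum; last by move=> j; exact: ltW.
  rewrite tsumZ// tsum_nsum; last by move=> j; rewrite exprn_ge0 ?expR_ge0.
  by rewrite ler_wpM2l ?expR_ge0.
have key j : e j * (expR (n%:R * k) * g j.+1 ^+ n) <= f j.
  rewrite /e /f /g -!expRM_natl -!expRD ler_expR shell_radius//; last exact: lt_le_trans n1'.
  have -> : expR (-1 + 2 * k + 2 * d) * expR (d * j%:R / 2) ^+ 2 =
      expR (-1 + 2 * k + 2 * d + d * j%:R) :> R.
    by rewrite -expRM_natl -expRD; congr expR; field.
  rewrite -[j.+1%:R]natr1 (_ : j%:R * - d = - (d * j%:R)) ?mulrN 1?[j%:R * d]mulrC//.
  exact: shell_exponent.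
have count j : summ (fun z => if P j z then 1 else 0 : R) /\
    nsum (fun z => if P j z then 1 else 0 : R) <= expR (n%:R * k) * g j.+1 ^+ n.
  have g1 : 1 <= g j.+1 by rewrite -expR0 ler_expR divr_ge0// mulr_ge0// ltW.
  apply: (summ_counting (intv_mul_inj BD) _ (hcount _ g1)).
  apply/seteqP; split => [_ [z /andP[z0 hz] <-]|y [/lattice_ofP[z ->] /andP[y0 hy]]] /=.
    split; first by apply/lattice_ofP; exists z.
    by rewrite hz andbT enorm_gt0 (intv_mul_eq0 _ BD).
  by exists z => //=; rewrite /P hy andbT; rewrite enorm_gt0 (intv_mul_eq0 _ BD) in y0.
(* Dividing by [f] j makes each inner sum at most 1, so that [summ_dep_prod] applies with outer
   weights [f]. *)
pose h (j : nat) (z : 'rV[int]_n) := e j / f j * (if P j z then 1 else 0).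
have h0 j z : 0 <= h j z by rewrite mulr_ge0 ?divr_ge0 ?expR_ge0 ?(ltW (f0 j))//; case: ifP.
have sh j : summ (h j) by apply: summZ; exact: (count j).1.
have nh j : nsum (h j) <= 1.
  rewrite -tsum_nsum// tsumZ; last exact: (count j).1.
  rewrite tsum_nsum; last by move=> z; case: ifP.
  rewrite mulrAC ler_pdivrMr// mul1r; apply: le_trans (key j).
  by rewrite ler_wpM2l ?expR_ge0//; exact: (count j).2.
have [sp np] := summ_dep_prod (fun j => ltW (f0 j)) h0 sf sh nh.
rewrite mul1r in np; apply: le_trans (le_trans np nf).
have p_ge0 (p : nat * 'rV[int]_n) : 0 <= f p.1 * h p.1 p.2 by rewrite mulr_ge0 ?(ltW (f0 _)).
rewrite -tsum_nsum// fubini_tsumC//.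
have nzs := gaussian_nz_summ DB 0 l0.
have pzs := summ_tsumC sp.
apply: (le_tsum _ nzs pzs) => z; case: ifPn => [z0|_]; last by apply: tsum_ge0 => j; exact: p_ge0 (j, z).
have [sw _ _] := fubini_nsum (fun p : 'rV[int]_n * nat => p_ge0 (p.2, p.1))
  ((summ_reindex _ (@swap_bij _ _)).2 sp).
rewrite tsum_nsum; last by move=> j; exact: p_ge0 (j, z).
have nz := hlam z z0; set y := enorm _ in nz.
have y0 : 0 < y by exact: lt_le_trans nz.
(* The real shell coordinate of z, with y = e^(dt/2) [lam]; its integer part is the index of the
   shell containing z. *)
pose t := 2 * ln (y / lam) / d.
have t0 : 0 <= t.
  rewrite divr_ge0 ?(ltW d0)// mulr_ge0// ln_ge0// ler_pdivlMr// mul1r//.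
have /andP[j1 j2] := truncn_itv t0; set j := Num.truncn t in j1 j2.
have yE : y = expR (d * t / 2) * lam.
  have -> : d * t / 2 = ln (y / lam) by rewrite /t; clear -d0; field; lra.
  by rewrite lnK ?posrE ?divr_gt0// divfK// gt_eqF.
apply: le_trans (le_nsum1 j (fun j => p_ge0 (j, z)) (sw z)) => /=.
have Pj : P j z.
  rewrite /P z0 /= -/y yE ler_wpM2r ?(ltW lam0)// ler_expR ler_wpM2r//.
  by rewrite ler_wpM2l ?(ltW d0)//; exact: ltW.
rewrite /h Pj mulr1 mulrCA divff ?gt_eqF// mulr1 /gaussian /e ler_expR lerN2.
rewrite subr0 -enorm_sqr -/y; apply: ler_wpM2l.
  by apply: mulr_ge0 (ltW l0); exact: pi_ge0.
rewrite lerXn2r ?nnegrE ?mulr_ge0 ?expR_ge0 ?(ltW lam0) ?(ltW y0)//.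
by rewrite yE ler_wpM2r ?(ltW lam0)// ler_expR ler_wpM2r// ler_wpM2l// ltW.
Qed.

End Lattices.

(** * The transference bound *)

Section Transference.
Variable R : realType.

Lemma near_exp_small (A c e : R) : 0 < A -> 0 < c -> 0 < e ->
  \forall n \near \oo, A * expR (- (n%:R * c)) < e.
Proof.
move=> A0 c0 e0; near=> n.
have : A / (e * c) <= n%:R by near: n; exact: nbhs_infty_ger.
rewrite ler_pdivrMr ?mulr_gt0// => h.
rewrite expRN ltr_pdivrMr ?expR_gt0//.
apply: lt_le_trans (ler_wpM2l (ltW e0) (expR_ge1Dx _)).
by rewrite mulrDr mulr1 mulrCA; lra.
Unshelve. all: by end_near.
Qed.

(** Of the loss e^(2d), one factor e^d is the square root of the margin in l, and the other is the
    enlargement of the ball, whose margin is taken as e^d - 1. *)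
Lemma transference_count n (B D : 'M[R]_n) (k d : R) : B *m D^T = 1%:M -> (1 <= n)%N ->
  0 < d -> -1 <= k ->
  3 * expR (- (n%:R * (expR d - 1) ^+ 2 / 2)) < 1 ->
  expR (5 - n%:R * d / 2) / (1 - expR (- d)) <= 1 / 2 ->
  0 < lambda1 (lattice_of D) ->
  (forall alpha, 1 <= alpha ->
    (num_short alpha (lattice_of D) <= (expR (n%:R * k) * alpha ^+ n)%:E)%E) ->
  covering_radius (lattice_of B) * lambda1 (lattice_of D) <=
    n%:R * (expR (2 * d) * (expR k / (2 * pi * Num.sqrt (expR 1)))).
Proof.
move=> BD n1 d0 k1 b1 b2 lam0 cnt; have p0 := pi_gt0 R.
set lam := lambda1 _ in lam0 *.
have n1' : 1 <= n%:R :> R by rewrite ler1n.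
have ed : 0 < expR d - 1 by rewrite subr_gt0 expR_gt1.
set l := n%:R / (2 * pi) * expR (-1 + 2 * k + 2 * d) / lam ^+ 2.
have l0 : 0 < l.
  rewrite /l divr_gt0 ?mulr_gt0 ?expR_gt0 ?exprn_gt0 ?invr_gt0 ?mulr_gt0//.
  exact: lt_le_trans n1'.
have hlam (z : 'rV[int]_n) : z != 0 -> lam <= enorm (intv R z *m D).
  move=> z0; apply: lambda1_le; first by apply/lattice_ofP; exists z.
  by rewrite (intv_mul_eq0 _ BD).
have h := le_trans (mass_nz_count BD n1 lam0 d0 k1 hlam cnt) b2.
have := covering_radius_mass BD l0 ed b1 h.
have e1 : Num.sqrt (expR 1) = expR (1 / 2) :> R.
  rewrite -[RHS](ger0_norm (expR_ge0 _)) -sqrtr_sqr -expRM_natl; congr (Num.sqrt (expR _)).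
  by field.
have -> : n%:R * (1 + (expR d - 1)) ^+ 2 * l / (2 * pi) =
    (n%:R * (expR (2 * d) * (expR k / (2 * pi * Num.sqrt (expR 1)))) / lam) ^+ 2.
  rewrite e1 /l (_ : 1 + (expR d - 1) = expR d); last by rewrite addrC subrK.
  have -> : expR (-1 + 2 * k + 2 * d) = expR d ^+ 2 * expR k ^+ 2 / expR (1 / 2) ^+ 2 :> R.
    by rewrite -!expRM_natl -expRN -!expRD; congr expR; field.
  rewrite (expRM_natl 2 d).
  have q0 := expR_gt0 (1 / 2 : R); move: (expR (1 / 2)) q0 => q q0.
  by clear -p0 lam0 q0; field; lra.
rewrite sqrtr_sqr ger0_norm; last first.
  by rewrite divr_ge0 ?(ltW lam0)// !mulr_ge0 ?expR_ge0// invr_ge0 !mulr_ge0 ?sqrtr_ge0 ?pi_ge0.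
by rewrite ler_pdivlMr.
Qed.

Lemma ln2_le1 : ln 2 <= 1 :> R.
Proof. by have := @le_ln1Dx R 1; rewrite (_ : 1 + 1 = 2)//; apply; lra. Qed.

Local Notation shortsup n := (ereal_sup [set num_short p.2 p.1 / (p.2 ^+ n)%:E
                   | p in [set p : set 'rV[R]_n * R
                          | is_lattice p.1 /\ (1 <= p.2)%R]])%E.

Lemma num_short_le n (L : set 'rV[R]_n) (K alpha : R) : is_lattice L -> 1 <= alpha ->
  shortsup n = K%:E -> (num_short alpha L <= (K * alpha ^+ n)%:E)%E.
Proof.
move=> hL a1 KE.
have a0 : 0 < alpha ^+ n by rewrite exprn_gt0//; lra.
have : (num_short alpha L / (alpha ^+ n)%:E <= K%:E)%E.
  by rewrite -KE; apply: ereal_sup_ubound; exists (L, alpha).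
by rewrite inver gt_eqF// lee_pdivrMr// EFinM.
Qed.

(** With radius factor 2, the approximation property of the infimum provides a short vector. This
    bounds the supremum in [beta_count] away from 0. *)
Lemma num_short2_ge1 n (L : set 'rV[R]_n) : 0 < lambda1 L -> (1 <= num_short 2 L)%E.
Proof.
move=> l0; rewrite /num_short /counting; case: asboolP => [fin|_]; last by rewrite leey.
have ne : [set enorm y | y in L `\ 0] !=set0.
  apply/set0P/eqP => e0; move: l0; rewrite /lambda1 e0 inf0 ltxx//.
have hi : has_inf [set enorm y | y in L `\ 0].
  by split=> //; exists 0 => _ [y _ <-]; exact: enorm_ge0.
have [_ [y [Ly y0] <-] hy] := inf_adherent l0 hi.
rewrite -/(lambda1 L) in hy.
rewrite lee_fin ler1n cardfs_gt0; apply/fset0Pn; exists y.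
rewrite in_fset_set// inE; split=> //; rewrite enorm_gt0.
have y0' : y != 0 by apply/eqP.
by rewrite y0' /=; apply: le_trans (ltW hy) _; rewrite mulr_natl mulr2n.
Qed.

Lemma exp2e_beta_fin n (K : R) : 0 < K -> (1 <= n)%N -> shortsup n = K%:E ->
  exp2e (beta_count R n) = (expR (n%:R^-1 * ln K))%:E.
Proof.
move=> K0 n1 KE; rewrite /beta_count KE log2e_EFin// -EFinM exp2e_EFin.
rewrite /powR pnatr_eq0 /=; congr (expR _)%:E.
by rewrite mulrA divfK// gt_eqF// ln_gt0// ltr1n.
Qed.

Lemma exp2e_beta_y n : (1 <= n)%N -> shortsup n = +oo%E -> exp2e (beta_count R n) = +oo%E.
Proof.
move=> n1 KE; have l2 : 0 < ln 2 :> R by rewrite ln_gt0// ltr1n.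
rewrite /beta_count KE /log2e /= inver gt_eqF//.
rewrite gt0_mulye ?lte_fin ?invr_gt0// gt0_muley ?lte_fin ?invr_gt0 ?ltr0n//.
by rewrite /exp2e gt0_mulye ?lte_fin.
Qed.

Lemma exp2e_ge0 (x : \bar R) : (0 <= exp2e x)%E.
Proof. exact: expeR_ge0. Qed.

(** Once d is fixed, the conditions of [transference_count] that restrict n compare an exponentially
    small quantity with a constant, so the threshold on n is uniform over all lattices. *)
Lemma transference_beta (d : R) : 0 < d -> \forall n \near \oo,
  forall (L : set 'rV[R]_n) (k : R), is_lattice L -> exp2e (beta_count R n) = k%:E ->
  covering_radius L * lambda1 (dual_lattice L) <=
  n%:R * (expR (2 * d) * (k / (2 * pi * Num.sqrt (expR 1)))).
Proof.
move=> d0; have ed : 0 < expR d - 1 by rewrite subr_gt0 expR_gt1.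
have ed' : 0 < 1 - expR (- d) by rewrite subr_gt0 expR_lt1 oppr_lt0.
near=> n; move=> L k hL kE.
have n1 : (1 <= n)%N by near: n; exact: nbhs_infty_ge.
have b1 : 3 * expR (- (n%:R * (expR d - 1) ^+ 2 / 2)) < 1.
  rewrite -mulrA; near: n; apply: near_exp_small => //.
  by rewrite divr_gt0// exprn_gt0.
have b2 : expR (5 - n%:R * d / 2) / (1 - expR (- d)) <= 1 / 2.
  rewrite ler_pdivrMr// expRD -mulrA ltW//; near: n; apply: near_exp_small => //.
  - by rewrite divr_gt0.
  - by rewrite mulr_gt0.
have [B [D [BD -> DE latD]]] := is_lattice_dual hL; rewrite DE.
have k0 : 0 <= k by rewrite -lee_fin -kE exp2e_ge0.
have := lambda1_ge0 (lattice_of D); rewrite le_eqVlt => /orP[/eqP <-|lam0].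
  rewrite mulr0 !mulr_ge0 ?expR_ge0// invr_ge0 !mulr_ge0 ?sqrtr_ge0 ?pi_ge0//.
have n0 : 0 < n%:R :> R by rewrite ltr0n.
(* Makes the logarithm meaningful and gives (ln K) / n >= - ln 2 >= -1, the lower bound on k
   required by the shell estimate. *)
have low : ((2 ^- n)%:E <= shortsup n)%E.
  apply: (@le_trans _ _ (num_short 2 (lattice_of D) / (2 ^+ n)%:E)%E).
    rewrite inver gt_eqF ?exprn_gt0// -[leLHS]mul1e lee_wpmul2r//.
    exact: num_short2_ge1.
  apply: ereal_sup_ubound; exists (lattice_of D, 2) => //=; split=> //.
  by rewrite ler1n.
case KE : (shortsup n) low => [K||] low; last by [].
  rewrite lee_fin in low.
  have K0 : 0 < K by apply: lt_le_trans low; rewrite invr_gt0 exprn_gt0.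
  move: kE; rewrite (exp2e_beta_fin K0 n1 KE) => -[<-].
  apply: transference_count => //.
    have : ln (2 ^- n) <= ln K by rewrite ler_ln ?posrE// invr_gt0 exprn_gt0.
    rewrite lnV ?posrE ?exprn_gt0// lnXn// => h.
    rewrite mulrC ler_pdivlMr// mulN1r; apply: le_trans h.
    by rewrite lerN2 -[ln 2 *+ n]mulr_natr ler_piMl// ln2_le1.
  move=> a a1; rewrite mulrA divff ?gt_eqF// mul1r lnK ?posrE//.
  exact: num_short_le.
by rewrite (exp2e_beta_y n1 KE) in kE.
Unshelve. all: by end_near.
Qed.

Lemma transference_le n (M : R) : (1 <= n)%N ->
  (forall L : set 'rV[R]_n, is_lattice L ->
    covering_radius L * lambda1 (dual_lattice L) <= n%:R * M) ->
  (transference R n <= M%:E)%E.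
Proof.
move=> n1 h; have n0 : 0 < n%:R :> R by rewrite ltr0n.
rewrite /transference lee_pdivrMl//.
by apply: ge_ereal_sup => _ [L hL <-]; rewrite -EFinM lee_fin h.
Qed.

Lemma transference_fin n : (1 <= n)%N -> exists2 T : R, transference R n = T%:E & T <= 9.
Proof.
move=> n1; have n0 : 0 < n%:R^-1 :> R by rewrite invr_gt0 ltr0n.
have le9 : (transference R n <= 9%:E)%E.
  apply: transference_le => // L hL.
  by have [B [D [BD -> -> _]]] := is_lattice_dual hL; exact: transference_banaszczyk.
have fin : transference R n \is a fin_num.
  rewrite fin_numElt (le_lt_trans le9 (ltry _)) andbT.
  have lat1 : is_lattice (lattice_of (1%:M : 'M[R]_n)).
    by exists 1%:M => //; rewrite row_free_unit unitmx1.
  set x := (covering_radius (lattice_of (1%:M : 'M[R]_n)) *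
    lambda1 (dual_lattice (lattice_of (1%:M : 'M[R]_n)))).
  apply: (@lt_le_trans _ _ ((n%:R^-1 * x)%:E)); first exact: ltNyr.
  rewrite EFinM; apply: lee_wpmul2l; first by rewrite lee_fin ltW.
  by apply: ereal_sup_ubound; exists (lattice_of (1%:M : 'M[R]_n)).
exists (fine (transference R n)); first by rewrite fineK.
by rewrite -lee_fin fineK.
Qed.

(* The term 1/(n+1) makes the inequality strict. *)
Definition excess (n : nat) : R :=
  (if exp2e (beta_count R n) == +oo%E then 0 else
    Num.max 0 (fine (transference R n) -
      fine (exp2e (beta_count R n)) / (2 * pi * Num.sqrt (expR 1)))) + n.+1%:R^-1.

End Transference.

Theorem mainTheorem2 (R : realType) :
  exists eps : nat -> R,
    (eps n @[n --> \oo] --> 0) /\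
    forall n : nat, (1 <= n)%N ->
      (transference R n
        < exp2e (beta_count R n) / (2 * pi * Num.sqrt (expR 1))%R%:E
          + (eps n)%:E)%E.
Proof.
have c0 : 0 < 2 * pi * Num.sqrt (expR 1) :> R.
  by rewrite !mulr_gt0 ?pi_gt0// sqrtr_gt0 expR_gt0.
exists (excess R); split; last first.
  move=> n n1; have [T TE _] := transference_fin R n1.
  rewrite /excess TE /= inver gt_eqF//.
  have i0 : 0 < n.+1%:R^-1 :> R by rewrite invr_gt0.
  have := exp2e_ge0 (beta_count R n).
  case: (exp2e _) => [k| |//] k0 /=.
    rewrite -EFinM -EFinD lte_fin; set e := Num.max _ _.
    have : T - k / (2 * pi * Num.sqrt (expR 1)) <= e by rewrite /e le_max lexx orbT.
    by rewrite lerBlDl => /le_lt_trans; apply; rewrite addrA ltrDl.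
  by rewrite gt0_mulye ?lte_fin ?invr_gt0// ltry.
apply/cvgrPdist_le => e'; move: (e' : R) => {e'}e e0.
(* With d = e / 36 and T <= 9, the excess T - X is at most T (1 - e^(-2d)) <= 9 * 2 * e / 36 = e / 2
   when T > 0; the other half of e absorbs 1 / (n + 1). *)
have d0 : 0 < e / 36 by rewrite divr_gt0.
near=> n; have n1 : (1 <= n)%N by near: n; exact: nbhs_infty_ge.
have [T TE T9] := transference_fin R n1.
have small : n.+1%:R^-1 <= e / 2.
  have : 2 / e <= n%:R by near: n; exact: nbhs_infty_ger.
  rewrite ler_pdivrMr// => h.
  rewrite -[leLHS]mul1r ler_pdivrMr// -[n.+1%:R]natr1; lra.
have i0 : 0 < n.+1%:R^-1 :> R by rewrite invr_gt0.
rewrite sub0r normrN /excess TE /=; case: eqP => [_|/eqP kfin].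
  rewrite add0r ger0_norm; last exact: ltW.
  by apply: le_trans small _; lra.
have : exp2e (beta_count R n) \is a fin_num by rewrite ge0_fin_numE ?exp2e_ge0// ltey.
move=> /fineK/esym; set k := fine _ => kE.
have main : T <= expR (2 * (e / 36)) * (k / (2 * pi * Num.sqrt (expR 1))).
  rewrite -lee_fin -TE; apply: transference_le => // L hL.
  move: L k hL kE; near: n; exact: transference_beta.
set X := k / _ in main *.
have TX : T - X <= e / 2.
  have h : expR (- (2 * (e / 36))) * T <= X.
    by rewrite expRN ler_pdivrMl ?expR_gt0.
  have X0 : 0 <= X by rewrite divr_ge0 ?(ltW c0)// -lee_fin -kE exp2e_ge0.
  have low := expR_ge1Dx (- (2 * (e / 36)) : R).
  have [T0|T0] := lerP T 0; first by lra.
  have := ler_wpM2r (ltW T0) low; nra.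
rewrite ger0_norm; last by rewrite addr_ge0 ?(ltW i0)// le_max lexx.
by rewrite [leRHS]splitr lerD// ge_max TX andbT; lra.
Unshelve. all: by end_near.
Qed.
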